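(* There are absolute constants $a,b,c$ such that the following holds. Let $(X_1,\ldots,X_n)$ be a finite exchangeable sequence of random variables with $\mathbb{E} X_1=0$ and $\mathbb{E} X_1^2=1$, and write $X=(X_1,\ldots,X_n)$. Let $\{\theta_i\}_{i=1}^k$ be an orthonormal set of vectors in $\mathbb{R}^n$, with $\theta_i=(\theta_i^1,\ldots,\theta_i^n)$, such that $\sum_{r=1}^n\theta_i^r=0$ for each $i$. Define the random vector $S_n=(S_n^1,\ldots,S_n^k)$ in $\mathbb{R}^k$ by $$S_n^i=\langle\theta_i,X\rangle=\sum_{r=1}^n\theta_i^rX_r.$$ Then for any $g\in C^2_c(\mathbb{R}^k)$, $$\big|\mathbb{E} g(S_n)-\mathbb{E} g(Z)\big|\le ak|g|_1\left(\sqrt{\big|\mathbb{E} X_1X_2X_3X_4\big|}+\sqrt{\big|\mathbb{E}(X_1^2-1)(X_2^2-1)\big|}\right)+b|g|_1\sqrt{\mathbb{E} X_1^4}\left(\sum_{i=1}^k\|\theta_i\|_4\right)^2+ck^2|g|_2\,\mathbb{E}|X_1|^3\left(\sum_{i=1}^k\|\theta_i\|_3^3\right),$$ where $Z$ is a standard Gaussian random vector in $\mathbb{R}^k$.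
   Context: A finite sequence $(X_1,\ldots,X_n)$ is exchangeable if $(X_1,\ldots,X_n)$ and $(X_{\sigma(1)},\ldots,X_{\sigma(n)})$ have the same distribution for every permutation $\sigma$ of $\{1,\ldots,n\}$. $C^2_c(\mathbb{R}^k)$ is the space of compactly supported, real-valued functions on $\mathbb{R}^k$ with two continuous derivatives. $|g|_1=\max_{1\le i\le k}\left\|\frac{\partial g}{\partial x_i}\right\|_\infty$ (sup norm) and $|g|_2=\max_{i,j}\sup_x\left|\frac{\partial^2 g}{\partial x_i\partial x_j}(x)\right|$. For $\theta\in\mathbb{R}^n$, $\|\theta\|_p=\left(\sum_{r=1}^n|\theta^r|^p\right)^{1/p}$, where superscripts $r$ on vectors denote coordinates. $\langle\cdot,\cdot\rangle$ is the standard inner product on $\mathbb{R}^n$. *)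

(* Defs.v *)
From HB Require Import structures.
From mathcomp Require Import all_boot all_order all_algebra perm.
From mathcomp Require Import all_classical all_reals all_analysis.
Set Implicit Arguments.
Unset Strict Implicit.
Unset Printing Implicit Defensive.
Import Order.TTheory GRing.Theory Num.Theory.
Import numFieldNormedType.Exports.
Local Open Scope classical_set_scope.
Local Open Scope ring_scope.

Section vectors.
Context {R : realType}.

Definition dotp n (u v : 'rV[R]_n) : R := \sum_(r < n) u 0 r * v 0 r.

Definition lpnorm n (p : R) (v : 'rV[R]_n) : R :=
  (\sum_(r < n) `|v 0 r| `^ p) `^ p^-1.

Definition orthonormal_family k n (theta : 'I_k -> 'rV[R]_n) : Prop :=
  forall i j, dotp (theta i) (theta j) = (i == j)%:R.

End vectors.

Section random_vectors.
Context {d : measure_display} {T : measurableType d} {R : realType}.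
Variable P : probability T R.

(* Laws are compared on measurable sets only: the value of [P] outside the
   sigma-algebra carries no meaning. *)
Definition exchangeable n (X : 'I_n -> {RV P >-> R}) : Prop :=
  forall (s : 'S_n) (A : set (n.-tuple R)), measurable A ->
    P [set w | A [tuple X i w | i < n]] =
    P [set w | A [tuple X (s i) w | i < n]].

Definition mutually_independent (I : finType) (X : I -> {RV P >-> R}) : Prop :=
  forall (J : {set I}) (A : I -> set R), (forall i, measurable (A i)) ->
    P (\bigcap_(i in [set` J]) (X i @^-1` A i)) =
    (\prod_(i in J) P (X i @^-1` A i))%E.

Definition standard_gaussian k (Z : 'I_k -> {RV P >-> R}) : Prop :=
  mutually_independent Z /\
  forall i (A : set R), measurable A ->
    distribution P (Z i) A = normal_prob 0 1 A.

End random_vectors.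

Section smooth_functions.
Context {R : realType} {k : nat}.
Implicit Types g : 'rV[R]_k -> R.

Definition partial (i : 'I_k) g : 'rV[R]_k -> R :=
  fun x => 'D_(delta_mx 0 i) g x.

Definition C1 g : Prop :=
  [/\ continuous g,
      forall i x, derivable g x (delta_mx 0 i) &
      forall i, continuous (partial i g)].

Definition C2 g : Prop := C1 g /\ forall i, C1 (partial i g).

Definition C2c g : Prop := C2 g /\ compact (closure [set x | g x != 0]).

(* The real-valued [sup] is [0] on unbounded sets; for [g] in [C2c] the partial
   derivatives below are continuous with compact support, hence bounded. *)
Definition sup_norm g : R := sup (range (fun x => `|g x|)).

Definition seminorm1 g : R :=
  \big[Num.max/0]_(i < k) sup_norm (partial i g).

Definition seminorm2 g : R :=
  \big[Num.max/0]_(i < k) \big[Num.max/0]_(j < k)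
    sup_norm (partial i (partial j g)).

End smooth_functions.

(* Main.v *)
Require Import Defs.
From HB Require Import structures.
From mathcomp Require Import all_boot all_order all_algebra perm.
From mathcomp Require Import all_classical all_reals all_analysis.
From mathcomp Require Import measurable_realfun.
From mathcomp Require Import zify ring lra.
Set Implicit Arguments.
Unset Strict Implicit.
Unset Printing Implicit Defensive.
Import Order.TTheory GRing.Theory Num.Theory.
Import numFieldNormedType.Exports.
Local Open Scope classical_set_scope.
Local Open Scope ring_scope.

(** The proof is Stein's method for an exchangeable pair: X and the sequence
obtained from X by transposing two of its coordinates have the same law. Write
S for S_n, let Z be independent of S, and interpolate along a rotation:
phi(t) = E g(sin t S + cos t Z), so that phi(0) = E g(Z) and
phi(pi/2) = E g(S). Since pi/2 <= 2, the mean value theorem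
([gaussian_comparison]) leaves a uniform bound on phi' to be proved.

Fix t and put s = sin t, c = cos t. Then phi'(t) = E sum_i (c S_i G_i(S) -
s K_ii(S)), where G_i(x) = E d_i g(s x + c Z) and
K_ij(x) = E Z_j d_i g(s x + c Z), the expectations being over Z. Gaussian
integration by parts ([gauss_vector_ibp]) gives K_ij = c E d_j d_i g(s x + c Z).
Hence for F(x) = E g(s x + c Z) the function c F has first derivatives s c G_i
and second derivatives s^2 K_ij, and K_ij is Lipschitz with a constant governed
by |g|_2. So c F can be expanded to second order with a cubic remainder although
g has only two derivatives ([smooth_taylor]).

Transposing coordinates r and t of X moves S by
D_i = (theta_i^r - theta_i^t)(X_t - X_r), and exchangeability gives
E (F(S + D) - F(S)) = 0. Sum the Taylor expansions over all r and t. As the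
theta_i have zero sum and are orthonormal, the D_i add up to - 2n S_i and the
D_i D_j to 4n(delta_ij + eps_ij) ([sum_swap_linear], [sum_swap_square]). The
first order terms and the delta_ij thus reproduce the integrand of phi'(t), and
phi'(t) is bounded by the first moments of the eps_ij, weighted by |g|_1, and by
the third moments of the D_i, weighted by |g|_2 ([stein_mean_bound]).

The error eps_ij consists of linear forms in the X_r^2 - 1 and of products of
linear forms in the X_r. By exchangeability the second moments of such forms
involve only E X_1^4, E (X_1^2 - 1)(X_2^2 - 1) and E X_1 X_2, and the last of
these is controlled by E X_1 X_2 X_3 X_4, by averaging the products of the
disjoint pairs of coordinates ([cross_moment_sqr_le]). All terms of order 1/n are
absorbed by the fourth norms, because ||theta||_4^4 >= 1/n for a unit vector
([mean_swap_error]).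

When E X_1^4 is infinite so is the bound, unless |g|_1 = 0; in that case g is
constant and the two expectations agree. *)

(** * Calculus on row vectors *)

Section calculus.
Context {R : realType}.

Lemma mean_value_between (f df : R -> R) (a b : R) :
  (forall x : R, is_derive x 1 f (df x)) ->
  exists2 c, `|c - a| <= `|b - a| & f b - f a = df c * (b - a).
Proof.
move=> fd.
have fc x y : {within `[x, y], continuous f}.
  apply: derivable_within_continuous => z _; exact: ex_derive.
have [ab|/ltW ba] := leP a b.
  have [c + ->] := MVT_segment ab (fun x _ => fd x) (fc a b).
  rewrite in_itv/= => /andP[ac cb]; exists c => //.
  by rewrite !ger0_norm ?subr_ge0// lerD2r.
have [c + e] := MVT_segment ba (fun x _ => fd x) (fc b a).
rewrite in_itv/= => /andP[bc ca]; exists c.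
  by rewrite !ler0_norm ?subr_le0// lerN2 lerD2r.
by rewrite -opprB e -mulrN opprB.
Qed.

Lemma cvg_sum {T : Type} (F : set_system T) {FF : Filter F} (I : Type)
    (r : seq I) (f : I -> T -> R) (l : I -> R) :
  (forall i, f i x @[x --> F] --> l i) ->
  \sum_(i <- r) f i x @[x --> F] --> \sum_(i <- r) l i.
Proof.
by move=> fl; apply: cvg_big => //; exact: add_continuous.
Qed.

Variable k : nat.
Implicit Types (u : 'rV[R]_k -> R) (x y d : 'rV[R]_k).

Definition norm1 d : R := \sum_i `|d 0 i|.

Lemma is_derive_line u x v (t : R) :
  derivable u (x + t *: v) v ->
  is_derive t 1 (fun t => u (x + t *: v)) ('D_v u (x + t *: v)).
Proof.
have E : (fun h : R => h^-1 *: (u (x + (h *: 1 + t) *: v) - u (x + t *: v)))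
    = (fun h : R => h^-1 *: (u (h *: v + (x + t *: v)) - u (x + t *: v))).
  apply/funext => h; congr (_ *: (u _ - _)).
  by rewrite scalerDl -!scalerA scale1r addrCA.
by move=> du; split; rewrite /derivable /derive E.
Qed.

(** The corners of a path of axis-parallel segments from 0 to [d]. *)
Definition row_head (m : nat) d := \row_(i < k) (if (i < m)%N then d 0 i else 0).

(** Walking from [x] to [x + d] one coordinate at a time makes every step a
mean value theorem in one variable, for which the partial derivatives are
enough. *)
Lemma box_mean_value u x d : C1 u ->
  exists2 xi : 'I_k -> 'rV[R]_k, forall m l, `|xi m 0 l| <= `|d 0 l| &
  u (x + d) - u x = \sum_m d 0 m * partial m u (x + xi m).
Proof.
move=> [_ du _].
have step (m : 'I_k) : exists2 z : 'rV[R]_k, (forall l, `|z 0 l| <= `|d 0 l|) &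
    u (x + row_head m.+1 d) - u (x + row_head m d) =
    d 0 m * partial m u (x + z).
  set y := x + row_head m d.
  have [t] := @mean_value_between (fun t => u (y + t *: delta_mx 0 m)) _ 0
    (d 0 m) (fun t => is_derive_line (du m _)).
  rewrite !subr0 scale0r addr0 => tm e.
  exists (row_head m d + t *: delta_mx 0 m).
    move=> l; rewrite !mxE/=; case: (ltngtP l m) => lm.
    - have -> : (l == m) = false by apply/eqP => lm'; rewrite lm' ltnn in lm.
      by rewrite mulr0 addr0.
    - have -> : (l == m) = false by apply/eqP => lm'; rewrite lm' ltnn in lm.
      by rewrite mulr0 addr0 normr0.
    - by have /eqP -> : l == m; [exact/eqP/val_inj|rewrite eqxx mulr1 add0r].
  rewrite addrA mulrC -e; congr (u _ - _).
  rewrite /y -addrA; congr (_ + _); apply/rowP => l; rewrite !mxE/= ltnS.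
  case: (ltngtP l m) => lm.
  - have -> : (l == m) = false by apply/eqP => lm'; rewrite lm' ltnn in lm.
    by rewrite mulr0 addr0.
  - have -> : (l == m) = false by apply/eqP => lm'; rewrite lm' ltnn in lm.
    by rewrite mulr0 addr0.
  - by have /eqP -> : l == m; [exact/eqP/val_inj|rewrite eqxx mulr1 add0r].
exists (fun m => s2val (cid2 (step m))).
  by move=> m; exact: (s2valP (cid2 (step m))).
transitivity (\sum_(m < k) (u (x + row_head m.+1 d) - u (x + row_head m d))).
  rewrite -(big_mkord xpredT (fun m => u (x + row_head m.+1 d)
    - u (x + row_head m d))) telescope_sumr//.
  congr (u _ - u _).
    by congr (_ + _); apply/rowP => i; rewrite !mxE ltn_ord.
  by rewrite -[LHS]addr0; congr (_ + _); apply/rowP => i; rewrite !mxE.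
apply: eq_bigr => m _; exact: (s2valP' (cid2 (step m))).
Qed.

Lemma norm1_ge0 d : 0 <= norm1 d.
Proof. exact: sumr_ge0. Qed.

Lemma C1_lipschitz u M x d : C1 u -> (forall i z, `|partial i u z| <= M) ->
  `|u (x + d) - u x| <= M * norm1 d.
Proof.
move=> u1 uM; have [xi _ ->] := box_mean_value x d u1.
apply: (le_trans (ler_norm_sum _ _ _)); rewrite mulr_sumr.
apply: ler_sum => i _; rewrite normrM mulrC.
by rewrite ler_wpM2r.
Qed.

(** The chain rule, read off from [box_mean_value]: the intermediate points tend
to [p t] and the partial derivatives are continuous there. *)
Lemma C1_path_derive u (p dp : R -> 'rV[R]_k) (t : R) : C1 u ->
  (forall i, is_derive t 1 (fun t => p t 0 i) (dp t 0 i)) ->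
  is_derive t 1 (fun t => u (p t)) (\sum_i dp t 0 i * partial i u (p t)).
Proof.
move=> u1 pd.
have /choice [xi xiP] : forall h : R, exists xi : 'I_k -> 'rV[R]_k,
    (forall m l, `|xi m 0 l| <= `|(p (h + t) - p t) 0 l|) /\
    u (p (h + t)) - u (p t) = \sum_m (p (h + t) - p t) 0 m * partial m u (p t + xi m).
  move=> h; have [xi xi1 xi2] := box_mean_value (p t) (p (h + t) - p t) u1.
  by exists xi; split => //; rewrite -xi2 [p t + _]addrC subrK.
have pc i : p (h + t) 0 i @[h --> 0^'] --> p t 0 i.
  have [/derivable1_diffP/differentiable_continuous pc _] := pd i.
  have : (fun h => p (h + t) 0 i) h @[h --> (0 : R)] --> p t 0 i.
    have := pc; rewrite -{1}[t]add0r => pc'.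
    rewrite -{2}[t]add0r.
    apply: (@continuous_comp _ _ _ (fun h : R => h + t) (fun t => p t 0 i)) => //.
    by apply: cvgD; [exact: cvg_id|exact: cvg_cst].
  exact: cvg_within_filter.
have xi0 m : p t + xi h m @[h --> 0^'] --> p t.
  have n0 : norm1 (p (h + t) - p t) @[h --> 0^'] --> (0 : R).
    rewrite -[X in _ --> X](@big1 R 0 +%R _ (index_enum 'I_k) xpredT (fun=> 0))//.
    apply: (cvg_sum (f := fun i h => `|(p (h + t) - p t) 0 i|) (l := fun=> 0)).
    move=> i; have ci : (p (h + t) - p t) 0 i @[h --> 0^'] --> (0 : R).
      under eq_cvg do rewrite !mxE.
      have := cvgB (pc i) (@cvg_cst _ (p t 0 i) _ (0^') _).
      by rewrite subrr => /(_ _ _); exact.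
    by have := cvg_norm ci; rewrite normr0 => /(_ _); exact.
  apply/cvg_ballP => e e0; near=> h.
  split=> // i j; rewrite (ord1 i) !mxE /ball/= opprD addNKr normrN.
  have /le_lt_trans -> // := (xiP h).1 m j.
  apply: (@le_lt_trans _ _ (norm1 (p (h + t) - p t))).
    by rewrite /norm1 (bigD1 j)//= lerDl sumr_ge0.
  rewrite -[ltLHS]ger0_norm ?norm1_ge0// -normrN -[X in `|X|]add0r.
  by near: h; exact: (cvgr_dist_lt _ _ n0).
suff H : (fun h => h^-1 *: (u (p (h *: 1 + t)) - u (p t))) h @[h --> 0^'] -->
   \sum_i dp t 0 i * partial i u (p t).
  split; first by apply/cvg_ex; eexists; exact: H.
  exact: cvg_lim H.
under eq_cvg => h.
  rewrite [h *: 1]mulr1 (xiP h).2 scaler_sumr.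
  under eq_bigr do rewrite scalerAl.
  over.
apply: (cvg_sum (f := fun i h => h^-1 *: (p (h + t) - p t) 0 i *
    partial i u (p t + xi h i))
  (l := fun i => dp t 0 i * partial i u (p t))) => i; apply: cvgM.
  have [/cvg_ex[/= l pl] pd2] := pd i.
  have : h^-1 *: (p (h *: 1 + t) 0 i - p t 0 i) @[h --> 0^'] --> dp t 0 i.
    by rewrite -pd2 /derive (cvg_lim _ pl).
  suff -> : (fun h => h^-1 *: (p (h + t) - p t) 0 i) =
    (fun h => h^-1 *: (p (h *: 1 + t) 0 i - p t 0 i)) by [].
  by apply/funext => h; rewrite !mxE [_ *: 1]mulr1.
apply: continuous_cvg => //.
by case: u1 => _ _; exact.
Unshelve. all: by end_near. Qed.

Lemma continuous_compact_bounded u (K : set 'rV[R]_k) : continuous u ->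
  compact K -> (forall x, ~ K x -> u x = 0) -> exists M, forall x, `|u x| <= M.
Proof.
move=> uc Kc u0.
have /compact_bounded [M [Mr MP]] : compact (u @` K).
  by apply: continuous_compact => //; exact: continuous_subspaceT.
have /MP{}MP : M < `|M| + 1 by rewrite (le_lt_trans (ler_norm _))// ltrDl.
exists (`|M| + 1) => x; have [Kx|/u0 ->] := pselect (K x); first by apply: MP; exists x.
by rewrite normr0 addr_ge0.
Qed.

Lemma partial_eq0 i u (K : set 'rV[R]_k) : closed K ->
  (forall x, ~ K x -> u x = 0) -> forall x, ~ K x -> partial i u x = 0.
Proof.
move=> Kc u0 x Kx; rewrite /partial.
have [d0|d0] := eqVneq (delta_mx 0 i : 'rV[R]_k) 0.
  by rewrite d0 derive0.
rewrite (@near_eq_derive _ _ _ u (cst 0)) ?derive_cst//.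
have : nbhs x (~` K) by apply: open_nbhs_nbhs; split => //; exact: closed_openC.
by apply: filterS => z /u0.
Qed.

Lemma sup_norm_ub u M : (forall x, `|u x| <= M) -> forall x, `|u x| <= sup_norm u.
Proof.
move=> uM x; apply: ub_le_sup; last by exists x.
by exists M => _ [z _ <-].
Qed.

Lemma C2c_bounded u : C2c u -> exists M, forall x, `|u x| <= M.
Proof.
move=> [[[uc _ _] _] Kc]; apply: (continuous_compact_bounded uc Kc) => x Kx.
by apply/eqP; apply: contra_notT Kx => ux; exact: subset_closure.
Qed.

Lemma seminorm1_ge0 u : 0 <= seminorm1 u.
Proof. by rewrite /seminorm1; elim/big_rec: _ => // i x _ x0; rewrite le_max x0 orbT. Qed.

Lemma seminorm2_ge0 u : 0 <= seminorm2 u.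
Proof. by rewrite /seminorm2; elim/big_rec: _ => // i x _ x0; rewrite le_max x0 orbT. Qed.

(** The partial derivatives vanish off the compact closure of the support, so
they are bounded and the supremum defining [sup_norm] is a true upper bound. *)
Lemma C2c_seminorm1 u i x : C2c u -> `|partial i u x| <= seminorm1 u.
Proof.
move=> [[[uc _ pc] _] Kc].
have [M uM] : exists M, forall x, `|partial i u x| <= M.
  apply: (continuous_compact_bounded (pc i) Kc); apply: partial_eq0.
    exact: closed_closure.
  move=> z Kz.
  by apply/eqP; apply: contra_notT Kz => ux; exact: subset_closure.
apply: (le_trans (sup_norm_ub uM x)).
exact: (le_bigmax _ (fun i => sup_norm (partial i u))).
Qed.

Lemma C2c_seminorm2 u i j x : C2c u ->
  `|partial i (partial j u) x| <= seminorm2 u.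
Proof.
move=> [[[uc _ pc] u2] Kc].
have [M uM] : exists M, forall x, `|partial i (partial j u) x| <= M.
  have [_ _ qc] := u2 j.
  apply: (continuous_compact_bounded (qc i) Kc).
  do 2 (apply: partial_eq0; first exact: closed_closure).
  move=> z Kz.
  by apply/eqP; apply: contra_notT Kz => ux; exact: subset_closure.
apply: (le_trans (sup_norm_ub uM x)).
apply: (le_trans (le_bigmax _ (fun j => sup_norm (partial i (partial j u))) j)).
exact: (le_bigmax _ (fun i => \big[Num.max/0]_(j < k) sup_norm (partial i (partial j u)))).
Qed.

End calculus.

(** * Measurability of continuous functions of a random vector *)

Section measurability.
Context {d : measure_display} {T : measurableType d} {R : realType}.

(** An open set of row vectors is the union of the boxes with rational centre and
radius 1/(m+1) that it contains. There are countably many of them, and that a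
box contains the random vector is a finite conjunction of conditions on the
coordinates. *)
Lemma measurable_continuous_row k (u : 'rV[R]_k -> R) (Y : 'I_k -> T -> R) :
  continuous u -> (forall i, measurable_fun setT (Y i)) ->
  measurable_fun setT (fun w => u (\row_i Y i w)).
Proof.
move=> /continuousP uc mY; apply: (measurability _ (RGenOpens.measurableE R)).
move=> _ [_ [a [b ->] <-]]; rewrite setTI.
have {uc} := uc _ (@interval_open R (BRight a) (BLeft b) isT isT).
set V := u @^-1` _ => oV.
pose box (c : {ffun 'I_k -> rat} * nat) :=
  ball (\row_i ratr (c.1 i) : 'rV[R]_k) c.2.+1%:R^-1 `<=` V.
pose F (c : {ffun 'I_k -> rat} * nat) : set T := if `[< box c >] then
  \bigcap_(i in [set: 'I_k]) (Y i @^-1` ball (ratr (c.1 i) : R) c.2.+1%:R^-1) else set0.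
rewrite [X in measurable X](_ : _ = \bigcup_c F c).
  apply: countable_bigcupT_measurable => [|c]; first exact: countableP.
  rewrite /F; case: asboolP => // _.
  apply: fin_bigcap_measurable => //.
  move=> i _; rewrite -[X in measurable X]setTI; apply: mY => //.
  exact: measurable_ball.
apply/seteqP; split=> [w|w [c _]]; last first.
  rewrite /F; case: asboolP => // cV wF.
  rewrite /preimage/=; apply: (cV (\row_i Y i w)); split => // i j.
  by rewrite !mxE; exact: wF.
move=> wV; have {}wV : V (\row_i Y i w) by exact: wV.
have /nbhs_ballP[e /= e0 eV] : nbhs (\row_i Y i w) V by exact: open_nbhs_nbhs.
pose m := Num.truncn (e^-1 * 2).
have m0 : (m.+1%:R^-1 : R) > 0 by rewrite invr_gt0.
have me : m.+1%:R^-1 < e / 2.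
  by rewrite -[ltRHS]invrK ltf_pV2 ?posrE ?invr_gt0 ?divr_gt0// invfM invrK Num.Theory.truncnS_gt.
have /choice[q qP] : forall i, exists q : rat, `|Y i w - ratr q| < m.+1%:R^-1.
  move=> i; have [|q] := @rat_in_itvoo R (Y i w - m.+1%:R^-1) (Y i w + m.+1%:R^-1).
    by rewrite ltrD2l gt0_cp.
  rewrite in_itv/= => /andP[q1 q2]; exists q.
  by rewrite ltr_distlC q1 q2.
exists ([ffun i => q i], m) => //.
rewrite /F asboolT/=.
  by move=> i _; rewrite /ball/= distrC ffunE; exact: qP.
move=> /= x [_ qx]; apply: eV; split => // i j.
rewrite (ord1 i) {i}; have {}qx := qx 0 j.
rewrite !mxE ffunE /ball/= in qx *.
rewrite (splitr e) (le_lt_trans (ler_distD (ratr (q j)) _ _))//.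
by rewrite ltrD// (lt_trans _ me)//; exact: qP.
Qed.

End measurability.

(** * Real-valued expectations *)

Section mean.
Context {d : measure_display} {T : measurableType d} {R : realType}.
Variable P : probability T R.
Implicit Types f g : T -> R.

(** [mean] is total, with value 0 when the integral is infinite or undefined; the
algebraic rules therefore carry [has_mean] as a hypothesis. *)
Definition has_mean f := P.-integrable setT (EFin \o f).
Definition mean f := \int[P]_w f w.

Lemma has_mean_measurable f : has_mean f -> measurable_fun setT f.
Proof. by move/measurable_int/measurable_EFinP. Qed.

Lemma has_mean_le g f : measurable_fun setT f -> has_mean g ->
  (forall w, `|f w| <= g w) -> has_mean f.
Proof.
move=> mf ig fg; apply: le_integrable ig => //; first exact/measurable_EFinP.
by move=> w _; rewrite /= lee_fin (le_trans (fg w))// ler_norm.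
Qed.

Lemma has_mean_cst c : has_mean (fun=> c).
Proof. exact: finite_measure_integrable_cst. Qed.

Lemma has_mean_bounded f M : measurable_fun setT f ->
  (forall w, `|f w| <= M) -> has_mean f.
Proof. by move=> mf fM; apply: (has_mean_le mf (has_mean_cst M)). Qed.

Lemma has_meanD f g : has_mean f -> has_mean g -> has_mean (fun w => f w + g w).
Proof. by move=> hf hg; exact: (integrableD measurableT hf hg). Qed.

Lemma has_meanB f g : has_mean f -> has_mean g -> has_mean (fun w => f w - g w).
Proof. by move=> hf hg; exact: (integrableB measurableT hf hg). Qed.

Lemma has_meanZ c f : has_mean f -> has_mean (fun w => c * f w).
Proof. by move=> hf; exact: (integrableZl measurableT c hf). Qed.

Lemma has_meanZr c f : has_mean f -> has_mean (fun w => f w * c).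
Proof.
move=> hf; rewrite (_ : (fun _ => _) = (fun w => c * f w)); first exact: has_meanZ.
by apply/funext => w; rewrite mulrC.
Qed.

Lemma has_mean_norm f : has_mean f -> has_mean (fun w => `|f w|).
Proof. exact: integrable_norm. Qed.

Lemma has_mean_sum (I : Type) (r : seq I) (F : I -> T -> R) :
  (forall i, has_mean (F i)) -> has_mean (fun w => \sum_(i <- r) F i w).
Proof.
move=> hF; rewrite /has_mean.
have -> : EFin \o (fun w => \sum_(i <- r) F i w) =
    (fun w => (\sum_(i <- r) (F i w)%:E)%E).
  by apply/funext => w /=; rewrite sumEFin.
by apply: integrable_sum => // i _; exact: hF.
Qed.

Lemma mean_cst c : mean (fun=> c) = c.
Proof. by rewrite /mean Rintegral_cst//= probability_setT mulr1. Qed.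

Lemma meanD f g : has_mean f -> has_mean g ->
  mean (fun w => f w + g w) = mean f + mean g.
Proof. by move=> hf hg; exact: RintegralD. Qed.

Lemma meanB f g : has_mean f -> has_mean g ->
  mean (fun w => f w - g w) = mean f - mean g.
Proof. by move=> hf hg; exact: RintegralB. Qed.

Lemma meanZ c f : has_mean f -> mean (fun w => c * f w) = c * mean f.
Proof. by move=> hf; exact: RintegralZl. Qed.

Lemma mean_sum (I : Type) (r : seq I) (F : I -> T -> R) :
  (forall i, has_mean (F i)) ->
  mean (fun w => \sum_(i <- r) F i w) = \sum_(i <- r) mean (F i).
Proof.
move=> hF; elim: r => [|i r IH].
  by rewrite big_nil -[RHS]mean_cst; apply: eq_Rintegral => w _; rewrite big_nil.
rewrite big_cons -IH -meanD//; last exact: has_mean_sum.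
by apply: eq_Rintegral => w _; rewrite big_cons.
Qed.

Lemma le_mean f g : has_mean f -> has_mean g -> (forall w, f w <= g w) ->
  mean f <= mean g.
Proof. by move=> hf hg fg; exact: le_Rintegral. Qed.

Lemma mean_ge0 f : (forall w, 0 <= f w) -> 0 <= mean f.
Proof. by move=> f0; exact: Rintegral_ge0. Qed.

Lemma norm_mean_le f g : has_mean f -> has_mean g -> (forall w, `|f w| <= g w) ->
  `|mean f| <= mean g.
Proof.
move=> hf hg fg; apply: (le_trans (le_normr_Rintegral measurableT hf)).
by apply: le_mean => //; exact: has_mean_norm.
Qed.

Lemma norm_mean_bounded f M : has_mean f -> (forall w, `|f w| <= M) ->
  `|mean f| <= M.
Proof.
by move=> hf fM; rewrite -[leRHS]mean_cst; apply: norm_mean_le => //; exact: has_mean_cst.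
Qed.

Lemma eq_mean f g : f =1 g -> mean f = mean g.
Proof. by move=> fg; apply: eq_Rintegral => w _; exact: fg. Qed.

(** With m the mean of |f|, integrate f^2 >= 2 m |f| - m^2. *)
Lemma mean_norm_sqr f : has_mean f -> has_mean (fun w => f w ^+ 2) ->
  mean (fun w => `|f w|) ^+ 2 <= mean (fun w => f w ^+ 2).
Proof.
move=> hf hf2; set m := mean _.
have hn := has_mean_norm hf.
have : 0 <= mean (fun w => f w ^+ 2 - (2 * m * `|f w| - m ^+ 2)).
  apply: mean_ge0 => w; have := sqr_ge0 (`|f w| - m).
  by rewrite -[f w ^+ 2]real_normK ?num_real//; nra.
rewrite meanB ?meanB ?mean_cst ?meanZ//; try exact: has_meanZ.
- by rewrite -/m; lra.
- exact: has_mean_cst.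
- by apply: has_meanB; [exact: has_meanZ|exact: has_mean_cst].
Qed.

Lemma mean_norm_le_sqr f y : 0 <= y -> has_mean f -> has_mean (fun w => f w ^+ 2) ->
  mean (fun w => f w ^+ 2) <= y ^+ 2 -> mean (fun w => `|f w|) <= y.
Proof.
move=> y0 hf hf2 fy; rewrite -(@ler_pXn2r _ 2)// ?nnegrE ?mean_ge0//.
exact: le_trans (mean_norm_sqr hf hf2) fy.
Qed.

Lemma has_mean_sqr f : measurable_fun setT f ->
  has_mean (fun w => f w ^+ 2) -> has_mean f.
Proof.
move=> mf hf2.
apply: (@has_mean_le (fun w => 1 + f w ^+ 2)) => //.
  by apply: has_meanD => //; exact: has_mean_cst.
by move=> w; rewrite -[f w ^+ 2]real_normK ?num_real//; have := normr_ge0 (f w); nra.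
Qed.

Lemma has_mean_mul f g : measurable_fun setT f -> measurable_fun setT g ->
  has_mean (fun w => f w ^+ 2) -> has_mean (fun w => g w ^+ 2) ->
  has_mean (fun w => f w * g w).
Proof.
move=> mf mg hf hg.
apply: (@has_mean_le (fun w => f w ^+ 2 + g w ^+ 2)); first exact: measurable_funM.
  exact: has_meanD.
move=> w; rewrite normrM -[f w ^+ 2]real_normK ?num_real//.
rewrite -[g w ^+ 2]real_normK ?num_real//.
have := sqr_ge0 (`|f w| - `|g w|); have := sqr_ge0 (`|f w| + `|g w|); nra.
Qed.

End mean.

(** * Gaussian integration by parts in one variable *)

Section normal.
Context {R : realType}.
Let mu := @lebesgue_measure R.
Let N : probability (measurableTypeR R) R := normal_prob (0 : R) 1.
Let phi := normal_pdf (0 : R) 1.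

Let phiE x : phi x = normal_peak 1 * expR (- x ^+ 2 / 2).
Proof.
rewrite /phi normal_pdfE ?oner_neq0// /normal_fun subr0 expr1n.
by rewrite -(mulr_natr 1 2) mul1r.
Qed.

Let mphi : measurable_fun setT phi.
Proof. exact: measurable_normal_pdf. Qed.

(** The density of the normal law is its Radon-Nikodym derivative, which gives the
change of measure for integrands of any sign. *)
Lemma normal_integral_density (f : R -> R) (U : set R) : measurable U ->
  measurable_fun U f -> N.-integrable U (EFin \o f) ->
  (\int[N]_(x in U) (f x)%:E = \int[mu]_(x in U) (f x * phi x)%:E)%E.
Proof.
move=> mU mf nf.
rewrite -(Radon_Nikodym_change_of_variables (normal_prob_dominates 0 1))//=.
under [RHS]eq_integral do rewrite EFinM.
apply: ae_eq_integral => //.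
- apply: emeasurable_funM => //; first exact/measurable_EFinP.
  apply: (measurable_int mu).
  apply: (integrableS _ _ (@subsetT _ _)) => //=.
  by apply: Radon_Nikodym_integrable; exact: normal_prob_dominates.
- apply: emeasurable_funM => //=; first exact/measurable_EFinP.
  by apply/measurable_funTS/measurable_EFinP.
- apply: ae_eqe_mul2l => /=.
  rewrite Radon_NikodymE//=; first exact: normal_prob_dominates.
  move=> abmu; case: cid => /= h [h1 h2 h3].
  apply: integral_ae_eq => //=.
  + exact: integrableS h2.
  + by apply/measurable_funTS/measurable_EFinP.
  + by move=> E E01 mE; rewrite -h3.
Qed.

(** As |x| <= 1 + x^2/4 <= exp(x^2/4), the function |x| [phi x] is dominated by
a multiple of the normal density of variance 2. The bound is proved on the
intervals [-n, n], where integrability is plain, and passes to the limit by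
monotone convergence. *)
Lemma normal_has_mean_id : has_mean N (fun x => x).
Proof.
apply/integrableP; split; first exact/measurable_EFinP.
pose F (n : nat) : set R := `[- n%:R, n%:R]%classic.
have -> : [set: R] = \bigcup_n F n.
  apply/seteqP; split=> // x _; exists (Num.truncn `|x|).+1 => //=.
  by rewrite /F/= in_itv/= -ler_norml ltW// Num.Theory.truncnS_gt.
pose c := normal_peak (1:R) * 2 / normal_peak (Num.sqrt (2:R)).
have s0 : Num.sqrt (2 : R) != 0 by rewrite sqrtr_eq0 -ltNge.
have cphi x : `|x| * phi x <= c * normal_pdf 0 (Num.sqrt 2) x.
  have -> : c * normal_pdf 0 (Num.sqrt 2) x =
      normal_peak 1 * (2 * normal_fun 0 (Num.sqrt 2) x).
    by rewrite normal_pdfE//= /c; field; rewrite gt_eqF// normal_peak_gt0.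
  rewrite phiE mulrCA ler_wpM2l ?normal_peak_ge0//.
  rewrite /normal_fun subr0 sqr_sqrtr//.
  have -> : - x ^+ 2 / 2 = x ^+ 2 / 4 * -1 + - x ^+ 2 / (2 *+ 2).
    by rewrite mulr2n; field.
  rewrite expRD mulrA ler_wpM2r ?expR_ge0//.
  rewrite mulrN1 expRN ler_pdivrMr ?expR_gt0//.
  have := expR_ge1Dx (x ^+ 2 / 4); have := sqr_ge0 (`|x| - 2).
  by rewrite -[x ^+ 2]real_normK ?num_real//; nra.
have bound n : (\int[N]_(x in F n) `|x|%:E <= c%:E)%E.
  have mF : measurable (F n) by exact: measurable_itv.
  rewrite normal_integral_density//; last first.
    apply: measurable_bounded_integrable => //.
      by rewrite (le_lt_trans (probability_le1 _ _)) ?ltry.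
    exists n%:R; split; first exact: num_real.
    move=> y ny x; rewrite /F/= in_itv/= -ler_norml => /le_trans; rewrite normr_id.
    by apply; exact: ltW.
  apply: (@le_trans _ _ (\int[mu]_x (c%:E * (normal_pdf 0 (Num.sqrt 2) x)%:E)))%E; last first.
    rewrite ge0_integralZl//=; last 3 first.
    - by apply/measurable_EFinP; exact: measurable_normal_pdf.
    - by move=> x _; rewrite lee_fin normal_pdf_ge0.
    - by rewrite lee_fin !mulr_ge0 ?invr_ge0 ?normal_peak_ge0.
    by rewrite integral_normal_pdf mule1.
  apply: (@le_trans _ _ (\int[mu]_x (`|x| * phi x)%:E))%E.
    apply: ge0_subset_integral => //.
      by apply/measurable_EFinP/measurable_funM.
    by move=> x _; rewrite lee_fin mulr_ge0 ?normal_pdf_ge0.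
  apply: ge0_le_integral => //.
  - by move=> x _; rewrite lee_fin mulr_ge0 ?normal_pdf_ge0.
  - by apply/measurable_EFinP/measurable_funM.
  - apply/measurable_EFinP/measurable_funM => //; exact: measurable_normal_pdf.
  - by move=> x _; rewrite -EFinM lee_fin.
have nd : nondecreasing_seq F.
  move=> m n mn; apply/subsetPset => x; rewrite /F/= !in_itv/= -!ler_norml.
  by move=> /le_trans; apply; rewrite ler_nat.
have mF n : measurable (F n) by exact: measurable_itv.
have mid n : measurable_fun (F n) (fun x => `|x|%:E : \bar R).
  exact/measurable_EFinP/measurable_funTS.
have cv := @ge0_nondecreasing_set_cvg_integral _ (measurableTypeR R) R F (fun x => `|x|%:E) N
  nd mF mid (fun n x _ => normr_ge0 x).
rewrite (le_lt_trans _ (ltry c))//= -(cvg_lim _ cv)//.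
by apply: lime_le; [exact: cvgP cv|exact: nearW].
Qed.

Lemma normal_has_mean_density (f : R -> R) : has_mean N f ->
  mu.-integrable setT (fun x => (f x * phi x)%:E).
Proof.
move=> hf; have mf := has_mean_measurable hf.
apply/integrableP; split; first exact/measurable_EFinP/measurable_funM.
rewrite (_ : (fun x => _) = (fun x => (`|f x| * phi x)%:E)); last first.
  by apply/funext => x /=; rewrite normrM (ger0_norm (normal_pdf_ge0 _ _ _)).
rewrite -normal_integral_density//; first by have /integrableP[] := hf.
- exact: measurableT_comp.
- exact: has_mean_norm.
Qed.

Lemma phi_derive (x : R) : is_derive x 1 phi (- x * phi x).
Proof.
have -> : phi = (fun x => normal_peak 1 * expR (- x ^+ 2 / 2)) by apply/funext.
apply: is_derive_eq.
by rewrite !scaler0 add0r /GRing.scale/=; field.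
Qed.

(** The derivative of u phi is (u'(x) - x u(x)) phi(x). Its integral over [-n, n]
is a difference of boundary values, which tend to 0 because [u] is bounded. *)
Lemma normal_ibp (u u' : R -> R) (M : R) :
  (forall x : R, is_derive x 1 u (u' x)) -> continuous u' ->
  (forall x, `|u x| <= M) -> (forall x, `|u' x| <= M) ->
  mean N (fun x => x * u x) = mean N u'.
Proof.
move=> du cu' uM u'M.
have cu : continuous u.
  by move=> x; apply/differentiable_continuous/derivable1_diffP; exact: ex_derive.
have mu_ : measurable_fun setT u by exact: continuous_measurable_fun.
have mu'_ : measurable_fun setT u' by exact: continuous_measurable_fun.
have hxu : has_mean N (fun x => x * u x).
  apply: (@has_mean_le _ _ _ N (fun x : R => M * `|x|) (fun x : R => x * u x)).
    exact: measurable_funM.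
    exact/has_meanZ/has_mean_norm/normal_has_mean_id.
  by move=> x; rewrite normrM mulrC ler_wpM2r.
have hu' : has_mean N u' by apply: (@has_mean_bounded _ _ _ N u' M).
pose h x := (u' x - x * u x) * phi x.
have ih : mu.-integrable setT (EFin \o h).
  exact: (@normal_has_mean_density (fun x => u' x - x * u x) (has_meanB hu' hxu)).
suff : (\int[mu]_x (h x)%:E = 0)%E.
  rewrite -normal_integral_density//; last 2 first.
  - by apply: measurable_funB => //; exact: measurable_funM.
  - exact: has_meanB.
  move=> /(congr1 fine)/= e0; have := meanB hu' hxu.
  by rewrite {1}/mean /Rintegral e0 => /esym/eqP; rewrite subr_eq0 => /eqP ->.
pose G x := u x * phi x.
have dG (x : R) : is_derive x 1 G (h x).
  have := phi_derive x; have := du x => d1 d2.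
  apply: is_derive_eq; rewrite /h /GRing.scale/=; ring.
have cG : continuous G.
  by move=> x; apply/differentiable_continuous/derivable1_diffP; exact: ex_derive.
have ch : continuous h.
  move=> x; apply: cvgM; last exact: continuous_normal_pdf.
  by apply: cvgB; [exact: cu'|apply: cvgM; [exact: cvg_id|exact: cu]].
pose F (n : nat) : set R := `[- n.+1%:R, n.+1%:R]%classic.
have I n : (\int[mu]_(x in F n) (h x)%:E = (G n.+1%:R - G (- n.+1%:R))%:E)%E.
  rewrite EFinB; apply: continuous_FTC2.
  - by rewrite gtrN.
  - exact: continuous_subspaceT.
  - split=> [x _||].
    + exact: ex_derive.
    + by apply: cvg_at_right_filter; exact: cG.
    + by apply: cvg_at_left_filter; exact: cG.
  - by move=> x _; rewrite derive1E derive_val.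
have cv : (\int[mu]_(x in F n) (h x)%:E @[n --> \oo] --> \int[mu]_x (h x)%:E)%E.
  have [] := @dominated_convergence _ _ _ mu setT measurableT
    (fun n => (EFin \o h) \_ (F n)) (EFin \o h) (abse \o (EFin \o h)).
  - move=> n; apply/(measurable_restrictT _ _).1 => //.
      exact: measurable_itv.
    by apply/measurable_EFinP/measurable_funTS; exact: continuous_measurable_fun.
  - by apply/measurable_EFinP; exact: continuous_measurable_fun.
  - apply: aeW => x _; apply: cvg_near_cst.
    near=> n; rewrite patchE mem_set//.
    rewrite /F/= in_itv/= -ler_norml; apply/ltW.
    rewrite (lt_trans (Num.Theory.truncnS_gt _))// ltr_nat ltnS.
    by near: n; exact: nbhs_infty_gt.
  - exact: integrable_abse.
  - apply: aeW => x n _; rewrite patchE; case: ifPn => //= _.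
    by rewrite lee_fin normr0.
  move=> _ _; apply: cvg_trans.
  by under eq_cvg do rewrite integral_mkcond.
have cv0 : (\int[mu]_(x in F n) (h x)%:E @[n --> \oo] --> 0)%E.
  under eq_cvg do rewrite I.
  apply: cvg_EFin; first exact: nearW.
  apply/cvgrPdist_le => e e0; near=> n; rewrite sub0r normrN /=.
  have Gle x : x ^+ 2 = n.+1%:R ^+ 2 -> `|G x| <= M * (normal_peak 1 * (2 / n.+1%:R)).
    move=> xn; rewrite /G normrM ler_pM//.
    have phi0 y : 0 <= phi y by exact: normal_pdf_ge0.
    rewrite (ger0_norm (phi0 _)) phiE.
    rewrite ler_wpM2l ?normal_peak_ge0// mulNr expRN -[leRHS]invrK lef_pV2 ?posrE ?expR_gt0 ?invr_gt0 ?divr_gt0//.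
    apply: le_trans (expR_ge1Dx _); rewrite invfM invrK xn.
    have : 1 <= n.+1%:R :> R by rewrite ler1n.
    nra.
  rewrite (le_trans (ler_normB _ _))//.
  rewrite (le_trans (lerD (Gle _ erefl) (Gle (- n.+1%:R) (sqrrN _))))//.
  have -> : M * (normal_peak 1 * (2 / n.+1%:R)) + M * (normal_peak 1 * (2 / n.+1%:R)) =
    M * normal_peak 1 * 4 / n.+1%:R by ring.
  rewrite ler_pdivrMr// -ler_pdivrMl// mulrC; apply/ltW.
  apply: (lt_trans (Num.Theory.truncnS_gt _)); rewrite ltr_nat ltnS.
  by near: n; exact: nbhs_infty_gt.
exact: (cvg_unique _ cv cv0).
Unshelve. all: by end_near. Qed.

End normal.

Section transfer.
Context {d1 d2 : measure_display} {T1 : measurableType d1}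
  {T2 : measurableType d2} {R : realType}.
Variables (P1 : probability T1 R) (P2 : probability T2 R) (Y : T1 -> T2).
Hypotheses (mY : measurable_fun setT Y)
  (PY : forall A, measurable A -> P1 (Y @^-1` A) = P2 A).
Variable f : T2 -> R.
Hypothesis hf : has_mean P2 f.

Let Ymixin := isMeasurableFun.Build _ _ _ _ _ mY.
Let Ypack : {RV P1 >-> T2} := HB.pack Y Ymixin.

Lemma has_mean_image : has_mean P1 (f \o Y).
Proof.
have mf := has_mean_measurable hf.
apply/integrableP; split; first exact/measurable_EFinP/measurableT_comp.
have mg : measurable_fun setT (fun x => `|(f x)%:E|%E).
  by apply/measurableT_comp => //; exact/measurable_EFinP.
rewrite -(@ge0_integral_distribution _ _ _ _ _ P1 Ypack _ mg)//.
rewrite (eq_measure_integral P2); first by have /integrableP[] := hf.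
by move=> A mA _; exact: PY.
Qed.

Lemma mean_image : mean P1 (f \o Y) = mean P2 f.
Proof.
have mf := has_mean_measurable hf.
have mg : measurable_fun setT (EFin \o f) by exact/measurable_EFinP.
congr fine.
have := @integral_distribution _ _ _ _ _ P1 Ypack _ mg has_mean_image => <-.
by apply: eq_measure_integral => A mA _; exact: PY.
Qed.

End transfer.

Section gaussian_variable.
Context {d : measure_display} {T : measurableType d} {R : realType}.
Variables (Q : probability T R) (Y : {RV Q >-> R}).
Let N : probability (measurableTypeR R) R := normal_prob (0 : R) 1.
Hypothesis YN : forall A : set R, measurable A ->
  distribution Q Y A = normal_prob 0 1 A.

Let mY : @measurable_fun _ _ T (measurableTypeR R) setT Y.
Proof. exact: (@measurable_funP _ _ _ _ setT Y). Qed.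

(** This is sqrt(2/pi), the constant through which the Gaussian enters the final
bound. *)
Definition normal_abs_moment : R := mean N (fun x => `|x : R|).

Lemma gaussian_has_mean : has_mean Q Y.
Proof.
exact: (@has_mean_image _ _ _ (measurableTypeR R) R Q N Y mY YN (fun x => x)
  normal_has_mean_id).
Qed.

Lemma gaussian_mean_norm : mean Q (fun w => `|Y w|) = normal_abs_moment.
Proof.
exact: (@mean_image _ _ _ (measurableTypeR R) R Q N Y mY YN (fun x => `|x : R|)
  (has_mean_norm normal_has_mean_id)).
Qed.

Lemma gaussian_ibp (u u' : R -> R) (M : R) :
  (forall x : R, is_derive x 1 u (u' x)) -> continuous u' ->
  (forall x, `|u x| <= M) -> (forall x, `|u' x| <= M) ->
  mean Q (fun w => Y w * u (Y w)) = mean Q (fun w => u' (Y w)).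
Proof.
move=> du cu' uM u'M.
have cu : continuous u.
  by move=> x; apply/differentiable_continuous/derivable1_diffP; exact: ex_derive.
have mu_ : measurable_fun setT u by exact: continuous_measurable_fun.
have mu'_ : measurable_fun setT u' by exact: continuous_measurable_fun.
have hxu : has_mean N (fun x : R => x * u x).
  apply: (@has_mean_le _ _ _ N (fun x : R => M * `|x|) (fun x : R => x * u x)).
    exact: measurable_funM.
    exact/has_meanZ/has_mean_norm/normal_has_mean_id.
  by move=> x; rewrite normrM mulrC ler_wpM2r.
have hu' : has_mean N u' by apply: (@has_mean_bounded _ _ _ N u' M).
have e1 := @mean_image _ _ _ (measurableTypeR R) R Q N Y mY
  YN (fun x : R => x * u x) hxu.
have e2 := @mean_image _ _ _ (measurableTypeR R) R Q N Y mY
  YN u' hu'.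
rewrite [LHS]e1 [RHS]e2; exact: normal_ibp du cu' uM u'M.
Qed.

End gaussian_variable.

Lemma is_derive_affine {R : realType} (a b t : R) :
  is_derive t 1 (fun x : R => a + x * b) b.
Proof.
apply: is_derive_eq; rewrite /GRing.scale/=; ring.
Qed.

(** * Gaussian integration by parts for vectors *)

Section tuple_laws.
Context {d : measure_display} {T : measurableType d} {R : realType} {k : nat}.
Variables m1 m2 : probability (k.-tuple T) R.

Definition tuple_rectangle (B : 'I_k -> set T) : set (k.-tuple T) :=
  [set t | forall i, B i (tnth t i)].

Lemma measurable_tuple_rectangle B : (forall i, measurable (B i)) ->
  measurable (tuple_rectangle B).
Proof.
move=> mB.
have -> : tuple_rectangle B = \bigcap_(i in [set: 'I_k]) ((@tnth _ T ^~ i) @^-1` B i).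
  by apply/seteqP; split=> t; [move=> tB i _; exact: tB|move=> tB i; exact: tB].
apply: fin_bigcap_measurable => // i _.
by rewrite -[X in measurable X]setTI; exact: measurable_tnth.
Qed.

(** Rectangles are stable under intersection and generate the product
sigma-algebra, so they determine a finite measure. *)
Lemma tuple_law_unique :
  (forall B, (forall i, measurable (B i)) ->
    m1 (tuple_rectangle B) = m2 (tuple_rectangle B)) ->
  forall A, measurable A -> m1 A = m2 A.
Proof.
move=> m12; pose G := [set tuple_rectangle B | B in [set B | forall i, measurable (B i)]].
move=> A mA.
apply: (g_sigma_algebra_measure_unique G _ (fun=> setT)) => //.
- by move=> _ [B mB <-]; exact: measurable_tuple_rectangle.
- by move=> _; exists (fun=> setT) => //; apply/seteqP; split.
- by apply/seteqP; split=> // t _; exists 0%N.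
- move=> _ _ [B mB <-] [C mC <-]; exists (fun i => B i `&` C i).
    by move=> i; exact: measurableI.
  apply/seteqP; split=> t /=; first by move=> BC; split=> i; have [] := BC i.
  by move=> [Bt Ct] i; split.
- by move=> _ [B mB <-]; exact: m12.
- by move=> _; exact: le_lt_trans (probability_le1 m1 measurableT) (ltry _).
apply: (smallest_sub (smallest_sigma_algebra _ _) _ mA) => C.
rewrite -bigcup_seq => -[i _ [B mB <-]].
apply: sub_sigma_algebra; exists (fun l => if l == i then B else setT); first by move=> l; case: ifP.
apply/seteqP; split=> t /=.
  by move=> /(_ i); rewrite eqxx => Bt; split.
by move=> [_ Bt] l; case: eqP => [->|].
Qed.

End tuple_laws.

Section gaussian_vector.
Context {d : measure_display} {T : measurableType d} {R : realType} {k : nat}.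
Variables (Q : probability T R) (Z : 'I_k -> {RV Q >-> R}).
Hypothesis gaussZ : standard_gaussian Z.

Let mZ i : measurable_fun setT (Z i).
Proof. exact: (@measurable_funP _ _ _ _ setT (Z i)). Qed.

Definition gauss_tuple w : k.-tuple R := [tuple Z i w | i < k].

Lemma measurable_gauss_tuple : measurable_fun setT gauss_tuple.
Proof.
apply/measurable_fun_tnthP => i.
by apply: eq_measurable_fun (mZ i) => w _ /=; rewrite tnth_mktuple.
Qed.

HB.instance Definition _ := isMeasurableFun.Build _ _ _ _ _ measurable_gauss_tuple.

(** The coordinate [j] is read at a second, independent sample point. Mutual
independence makes this tuple equal in law to the Gaussian tuple, so that by
Fubini one coordinate can be integrated while all others are frozen. *)
Definition gauss_resample (j : 'I_k) (ww : T * T) : k.-tuple R :=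
  [tuple Z i (if i == j then ww.2 else ww.1) | i < k].

Lemma measurable_gauss_resample j : measurable_fun setT (gauss_resample j).
Proof.
apply/measurable_fun_tnthP => i.
apply: (@eq_measurable_fun _ _ _ _ _ (fun ww => Z i (if i == j then ww.2 else ww.1))).
  by move=> w _ /=; rewrite tnth_mktuple.
by case: (i == j); apply: measurableT_comp.
Qed.

Lemma gauss_resample_law j (A : set (k.-tuple R)) : measurable A ->
  (Q \x Q)%E (gauss_resample j @^-1` A) = distribution Q gauss_tuple A.
Proof.
pose Psi : {RV (Q \x Q)%E >-> k.-tuple R} :=
  HB.pack (gauss_resample j) (isMeasurableFun.Build _ _ _ _ _ (measurable_gauss_resample j)).
move: A; apply: (@tuple_law_unique _ _ _ _ (distribution (Q \x Q)%E Psi)) => B mB.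
have [indep _] := gaussZ.
have mBj i : measurable (Z i @^-1` B i).
  by rewrite -[X in measurable X]setTI; exact: mZ.
transitivity (\prod_(i < k) Q (Z i @^-1` B i))%E; last first.
  have := indep [set: 'I_k]%SET B mB.
  under eq_bigl do rewrite finset.in_setT.
  move=> <-; congr (Q _); apply/seteqP; split=> w /=.
    by move=> Bw i; have := Bw i; rewrite /= tnth_mktuple finset.in_setT; exact.
  by move=> Bw i _; have := Bw i; rewrite /= tnth_mktuple.
rewrite [RHS](bigD1 j)//= muleC.
have -> : (\prod_(i < k | i != j) Q (Z i @^-1` B i))%E =
    Q (\bigcap_(i in [set` ([set: 'I_k] :\ j)%SET]) Z i @^-1` B i).
  rewrite indep//; apply: eq_bigl => i.
  by rewrite finset.in_setD1 finset.in_setT andbT.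
rewrite -product_measure1E//.
- congr (product_measure1 _ _ _); apply/seteqP; split=> -[w w']/=.
    move=> Bw; split=> [i|].
      by rewrite /= finset.in_setD1 finset.in_setT andbT => /negbTE ij; have := Bw i; rewrite /= tnth_mktuple ij.
    by have := Bw j; rewrite /= tnth_mktuple eqxx.
  move=> [Bw Bw'] i; rewrite /= tnth_mktuple.
  have [->//|ij] := eqVneq i j.
  by apply: Bw; rewrite /= finset.in_setD1 finset.in_setT andbT.
- by apply: fin_bigcap_measurable.
Qed.

Lemma mean_gauss_resample j (f : k.-tuple R -> R) : has_mean Q (f \o gauss_tuple) ->
  measurable_fun setT f ->
  (forall w, has_mean Q (fun w' => f (gauss_resample j (w, w')))) ->
  mean Q (f \o gauss_tuple) = mean Q (fun w => mean Q (fun w' => f (gauss_resample j (w, w')))).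
Proof.
move=> hf mf hfj.
have hd : has_mean (distribution Q gauss_tuple) f.
  by apply: integrable_pushforward => //; exact/measurable_EFinP.
rewrite (mean_image (measurable_gauss_tuple) (fun A _ => erefl : Q _ = distribution Q gauss_tuple A) hd).
rewrite -(mean_image (measurable_gauss_resample j) (gauss_resample_law j) hd).
have hp := has_mean_image (measurable_gauss_resample j) (gauss_resample_law j) hd.
rewrite /mean /Rintegral -integral12_prod_meas1//.
congr fine; apply: eq_integral => w _; rewrite fineK//.
exact: integrable_fin_num (hfj w).
Qed.

(** With the coordinates other than [j] frozen this is [gaussian_ibp]. *)
Lemma gauss_vector_ibp (u : 'rV[R]_k -> R) (x : 'rV[R]_k) (c M : R) j : C1 u ->
  (forall y, `|u y| <= M) -> (forall y, `|partial j u y| <= M) ->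
  mean Q (fun w => Z j w * u (x + c *: \row_i Z i w)) =
  c * mean Q (fun w => partial j u (x + c *: \row_i Z i w)).
Proof.
move=> u1 uM duM; have [uc du duc] := u1.
have lc : continuous (fun y : 'rV[R]_k => x + c *: y).
  by move=> y; exact: cvgD (cvg_cst _) (cvgZ (cvg_cst _) cvg_id).
have ucc : continuous (fun y : 'rV[R]_k => u (x + c *: y)).
  by move=> y; apply: (continuous_comp (lc y)); exact: uc.
have ducc : continuous (fun y : 'rV[R]_k => partial j u (x + c *: y)).
  by move=> y; apply: (continuous_comp (lc y)); exact: duc.
pose f1 (t : k.-tuple R) := tnth t j * u (x + c *: \row_i tnth t i).
pose f2 (t : k.-tuple R) := c * partial j u (x + c *: \row_i tnth t i).
have mf1 : measurable_fun setT f1.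
  apply: measurable_funM; first exact: measurable_tnth.
  apply: (measurable_continuous_row ucc) => i; exact: measurable_tnth.
have mf2 : measurable_fun setT f2.
  apply: measurable_funM => //.
  apply: (measurable_continuous_row ducc) => i; exact: measurable_tnth.
have zrow w : \row_i tnth (gauss_tuple w) i = \row_i Z i w.
  by apply/rowP => i; rewrite !mxE tnth_mktuple.
have hZ i := @gaussian_has_mean _ _ _ _ (Z i) (gaussZ.2 i).
have hf1 : has_mean Q (f1 \o gauss_tuple).
  apply: (@has_mean_le _ _ _ _ (fun w => M * `|Z j w|)).
  - exact: measurableT_comp mf1 measurable_gauss_tuple.
  - exact/has_meanZ/has_mean_norm.
  - by move=> w; rewrite /= /f1 tnth_mktuple normrM mulrC ler_wpM2r.
have hf2 : has_mean Q (f2 \o gauss_tuple).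
  apply: (@has_mean_bounded _ _ _ _ _ (`|c| * M)).
  - exact: measurableT_comp mf2 measurable_gauss_tuple.
  - by move=> w; rewrite /= /f2 normrM ler_wpM2l.
transitivity (mean Q (f1 \o gauss_tuple)).
  by apply: eq_mean => w /=; rewrite /f1 zrow tnth_mktuple.
rewrite -meanZ; last first.
  apply: (@has_mean_bounded _ _ _ _ _ M) => //.
  exact: (measurable_continuous_row ducc).
transitivity (mean Q (f2 \o gauss_tuple)); last first.
  by apply: eq_mean => w /=; rewrite /f2 zrow.
have hj1 w : has_mean Q (fun w' => f1 (gauss_resample j (w, w'))).
  apply: (@has_mean_le _ _ _ _ (fun w => M * `|Z j w|)).
  - apply: measurableT_comp mf1 _; apply: measurableT_comp (measurable_gauss_resample j) _.
    exact: pair1_measurable.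
  - exact/has_meanZ/has_mean_norm.
  - by move=> w'; rewrite /= /f1 tnth_mktuple eqxx normrM mulrC ler_wpM2r.
have hj2 w : has_mean Q (fun w' => f2 (gauss_resample j (w, w'))).
  apply: (@has_mean_bounded _ _ _ _ _ (`|c| * M)).
  - apply: measurableT_comp mf2 _; apply: measurableT_comp (measurable_gauss_resample j) _.
    exact: pair1_measurable.
  - by move=> w'; rewrite /= /f2 normrM ler_wpM2l.
rewrite (mean_gauss_resample hf1 mf1 hj1) (mean_gauss_resample hf2 mf2 hj2).
apply: eq_mean => w.
pose y := x + c *: \row_i (if i == j then 0 else Z i w).
have rE w' : x + c *: \row_i tnth (gauss_resample j (w, w')) i =
    y + Z j w' *: (c *: delta_mx 0 j).
  rewrite /y -addrA; congr (_ + _); apply/rowP => i; rewrite !mxE tnth_mktuple/=.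
  by case: eqP => [->|_]; rewrite ?mulr0 ?mulr1 ?add0r ?addr0// mulrC.
pose v t := u (y + t *: (c *: delta_mx 0 j)).
pose v' t := c * partial j u (y + t *: (c *: delta_mx 0 j)).
have -> : mean Q (fun w' => f1 (gauss_resample j (w, w'))) = mean Q (fun w' => Z j w' * v (Z j w')).
  by apply: eq_mean => w'; rewrite /f1 rE tnth_mktuple eqxx.
have -> : mean Q (fun w' => f2 (gauss_resample j (w, w'))) = mean Q (fun w' => v' (Z j w')).
  by apply: eq_mean => w'; rewrite /f2 rE.
apply: (@gaussian_ibp _ _ _ _ (Z j) (gaussZ.2 j) v v' (M + `|c| * M)).
- move=> t; have := @C1_path_derive _ _ u (fun t => y + t *: (c *: delta_mx 0 j))
    (fun=> c *: delta_mx 0 j) t u1.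
  rewrite (bigD1 j)//= big1 ?addr0; last first.
    by move=> i ij; rewrite !mxE (negbTE ij) mulr0 mul0r.
  rewrite !mxE !eqxx mulr1; apply => i.
  under eq_fun do rewrite !mxE.
  by rewrite !mxE; exact: is_derive_affine.
- move=> t; apply: cvgM; first exact: cvg_cst.
  apply: continuous_comp; last exact: duc.
  exact: cvgD (cvg_cst _) (cvgZ cvg_id (cvg_cst _)).
- by move=> t; rewrite (le_trans (uM _))// lerDl mulr_ge0// (le_trans _ (uM 0)).
- move=> t; rewrite normrM (le_trans (ler_wpM2l _ (duM _)))//.
  by rewrite lerDr (le_trans _ (uM 0)).
Qed.

End gaussian_vector.

(** * Gaussian smoothing *)

Lemma norm1_lipschitz_continuous {R : realType} k (F : 'rV[R]_k -> R) L :
  (forall y d, `|F (y + d) - F y| <= L * norm1 d) -> continuous F.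
Proof.
move=> FL y; apply/(@cvgrPdist_le R R _ (nbhs y) (nbhs_filter y)) => e e0.
have L1 : 0 < `|L| * k%:R + 1 by rewrite ltr_wpDl// mulr_ge0.
apply/nbhs_ballP; exists (e / (`|L| * k%:R + 1)); first by rewrite /= divr_gt0.
move=> z [_ yz]; rewrite -[z](subrKC y) distrC.
rewrite (le_trans (FL _ _))//.
apply: (@le_trans _ _ (`|L| * (k%:R * (e / (`|L| * k%:R + 1))))).
  rewrite (le_trans (ler_wpM2r (norm1_ge0 _) (ler_norm _)))//.
  rewrite ler_wpM2l// /norm1.
  have -> : k%:R * (e / (`|L| * k%:R + 1)) = \sum_(i < k) (e / (`|L| * k%:R + 1)).
    by rewrite sumr_const card_ord mulr_natl.
  apply: ler_sum => i _.
  by rewrite !mxE distrC; apply/ltW; exact: yz.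
rewrite !mulrA ler_pdivrMr// [leRHS]mulrC ler_wpM2r ?ltW//.
by rewrite ltrDl.
Qed.

Section smoothing.
Context {d : measure_display} {T : measurableType d} {R : realType} {k : nat}.
Variables (Q : probability T R) (Z : 'I_k -> {RV Q >-> R}).
Hypothesis gaussZ : standard_gaussian Z.
Implicit Types (u : 'rV[R]_k -> R) (x y : 'rV[R]_k) (c M : R).

Let mZ i : measurable_fun setT (Z i).
Proof. exact: (@measurable_funP _ _ _ _ setT (Z i)). Qed.

Let C := @normal_abs_moment R.

Let hZ i : has_mean Q (Z i).
Proof. exact: gaussian_has_mean (gaussZ.2 i). Qed.

Let EZ i : mean Q (fun w => `|Z i w|) = C.
Proof. exact: gaussian_mean_norm (gaussZ.2 i). Qed.

Let zr w : 'rV[R]_k := \row_i Z i w.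

Definition smooth c u y := mean Q (fun w => u (y + c *: zr w)).

(** The weighted average [wsmooth c j u] is [c] times the average of the [j]-th
derivative of [u] ([wsmoothE]), yet its size is controlled by [u] alone: this is
the derivative gained by smoothing. *)
Definition wsmooth c j u y := mean Q (fun w => Z j w * u (y + c *: zr w)).

Lemma measurable_shift c u y : continuous u ->
  measurable_fun setT (fun w => u (y + c *: zr w)).
Proof.
move=> uc; apply: (@measurable_continuous_row _ _ _ _ (fun z => u (y + c *: z))) => //.
move=> z; apply: (@continuous_comp _ _ _ (fun z : 'rV[R]_k => y + c *: z)); last exact: uc.
exact: cvgD (cvg_cst _) (cvgZ (cvg_cst _) cvg_id).
Qed.

Lemma has_mean_shift c u y M : continuous u -> (forall x, `|u x| <= M) ->
  has_mean Q (fun w => u (y + c *: zr w)).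
Proof.
by move=> uc uM; apply: has_mean_bounded (measurable_shift c y uc) _ => w; exact: uM.
Qed.

Lemma has_mean_wshift c j u y M : continuous u -> (forall x, `|u x| <= M) ->
  has_mean Q (fun w => Z j w * u (y + c *: zr w)).
Proof.
move=> uc uM; apply: (@has_mean_le _ _ _ _ (fun w => M * `|Z j w|)).
- exact: measurable_funM (mZ j) (measurable_shift c y uc).
- exact/has_meanZ/has_mean_norm.
- by move=> w; rewrite normrM mulrC ler_wpM2r.
Qed.

Lemma smooth_bound c u y M : continuous u -> (forall x, `|u x| <= M) ->
  `|smooth c u y| <= M.
Proof. by move=> uc uM; apply: norm_mean_bounded => //; exact: has_mean_shift uM. Qed.

Lemma wsmooth_bound c j u y M : continuous u -> (forall x, `|u x| <= M) ->
  `|wsmooth c j u y| <= M * C.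
Proof.
move=> uc uM; rewrite -(EZ j) -meanZ; last exact: has_mean_norm.
apply: norm_mean_le; [exact: has_mean_wshift uM|exact/has_meanZ/has_mean_norm|].
by move=> w; rewrite normrM mulrC ler_wpM2r.
Qed.

Lemma normal_abs_moment_ge0 : 0 <= C.
Proof. exact: mean_ge0. Qed.

Lemma smooth_at0 u y : smooth 0 u y = u y.
Proof.
rewrite -[RHS](mean_cst Q); apply: eq_mean => w.
by rewrite scale0r addr0.
Qed.

Lemma smooth_std u : smooth 1 u 0 = mean Q (fun w => u (zr w)).
Proof. by apply: eq_mean => w; rewrite add0r scale1r. Qed.

Lemma smooth_lipschitz c u y dl M0 M : C1 u -> (forall x, `|u x| <= M0) ->
  (forall i x, `|partial i u x| <= M) ->
  `|smooth c u (y + dl) - smooth c u y| <= M * norm1 dl.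
Proof.
move=> u1 uM0 uM; have [uc _ _] := u1.
rewrite /smooth -meanB; try exact: has_mean_shift uM0.
apply: norm_mean_bounded; first by apply: has_meanB; exact: has_mean_shift uM0.
by move=> w; rewrite addrAC; exact: C1_lipschitz.
Qed.

Lemma wsmooth_lipschitz c j u y dl M0 M : C1 u -> (forall x, `|u x| <= M0) ->
  (forall i x, `|partial i u x| <= M) ->
  `|wsmooth c j u (y + dl) - wsmooth c j u y| <= C * M * norm1 dl.
Proof.
move=> u1 uM0 uM; have [uc _ _] := u1.
rewrite /wsmooth -meanB; try exact: has_mean_wshift uM0.
rewrite -(EZ j) -mulrA mulrC -meanZ; last exact: has_mean_norm.
apply: norm_mean_le.
- by apply: has_meanB; exact: has_mean_wshift uM0.
- exact/has_meanZ/has_mean_norm.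
move=> w; rewrite -mulrBr normrM mulrC ler_wpM2r// addrAC; exact: C1_lipschitz.
Qed.

Lemma wsmoothE c j u y M0 M : C1 u -> (forall x, `|u x| <= M0) ->
  (forall i x, `|partial i u x| <= M) ->
  wsmooth c j u y = c * smooth c (partial j u) y.
Proof.
move=> u1 uM0 uM; apply: (@gauss_vector_ibp _ _ _ _ _ _ gaussZ _ _ _ (M0 + M)) => //.
- by move=> x; rewrite (le_trans (uM0 x))// lerDl (le_trans _ (uM j 0)).
- by move=> x; rewrite (le_trans (uM j x))// lerDr (le_trans _ (uM0 0)).
Qed.

(** Differentiation under the expectation. The derivative grows linearly in the
[Z i], so bounds on the velocities [a'] and [c'] provide an integrable
majorant. *)
Lemma smooth_path_derive u (a a' : R -> 'rV[R]_k) (c c' : R -> R) (A B M0 M t : R) :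
  C1 u -> (forall x, `|u x| <= M0) -> (forall i x, `|partial i u x| <= M) ->
  (forall (t : R) i, is_derive t 1 (fun t => a t 0 i) (a' t 0 i)) ->
  (forall t : R, is_derive t 1 c (c' t)) ->
  (forall t i, `|a' t 0 i| <= A) -> (forall t, `|c' t| <= B) ->
  is_derive t 1 (fun t => smooth (c t) u (a t))
    (\sum_i (a' t 0 i * smooth (c t) (partial i u) (a t) +
             c' t * wsmooth (c t) i (partial i u) (a t))).
Proof.
move=> u1 uM0 uM da dc aA cB; have [uc _ duc] := u1.
have D (w : T) (s : R) : is_derive s 1 (fun s => u (a s + c s *: zr w))
    (\sum_i (a' s + c' s *: zr w) 0 i * partial i u (a s + c s *: zr w)).
  apply: (@C1_path_derive _ _ u (fun s => a s + c s *: zr w) (fun s => a' s + c' s *: zr w)) => //.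
  move=> i; rewrite !mxE; under eq_fun do rewrite !mxE.
  have := da s i; have := dc s => d1 d2.
  by apply: is_derive_eq; rewrite scaler0 add0r /GRing.scale/= mulrC.
pose F s w := u (a s + c s *: zr w).
pose G w := \sum_i (A + B * `|Z i w|) * M.
have intF s : `]t - 1, t + 1[%classic s -> Q.-integrable setT (EFin \o F s).
  by move=> _; exact: has_mean_shift uM0.
have dF s w : `]t - 1, t + 1[%classic s -> [set: T] w -> derivable (F ^~ w) s 1.
  by move=> _ _; exact: ex_derive.
have It : `]t - 1, t + 1[%classic t.
  by rewrite /= in_itv/= ltrDl ltrBlDr ltrDl ltr01.
have G0 w : 0 <= G w.
  have A0 (i : 'I_k) : 0 <= A by rewrite (le_trans _ (aA t i)).
  have B0 : 0 <= B by rewrite (le_trans _ (cB t)).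
  apply: sumr_ge0 => i _; rewrite mulr_ge0 ?addr_ge0 ?mulr_ge0 ?A0//.
  by rewrite (le_trans _ (uM i 0)).
have intG : has_mean Q G.
  apply: has_mean_sum => i.
  exact/has_meanZr/has_meanD/has_meanZ/has_mean_norm/hZ/has_mean_cst.
have Gub s w : `]t - 1, t + 1[%classic s -> [set: T] w -> `|partial1of2 F s w| <= G w.
  move=> _ _; rewrite partial1of2E (@derive_val _ _ _ _ _ _ _ (D w s)).
  rewrite (le_trans (ler_norm_sum _ _ _))//; apply: ler_sum => i _.
  rewrite normrM ler_pM// !mxE (le_trans (ler_normD _ _))// lerD// normrM.
  by rewrite ler_wpM2r.
have der := derivable_under_integral measurableT It intF dF G0 intG Gub.
have val := differentiation_under_integral measurableT It intF dF G0 intG Gub.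
suff <- : (fun s => \int[Q]_(w in setT) F s w)^`()%classic t = \sum_i (a' t 0 i * smooth (c t) (partial i u) (a t) +
             c' t * wsmooth (c t) i (partial i u) (a t)).
  by rewrite derive1E; split.
rewrite val.
transitivity (mean Q (fun w => \sum_i (a' t 0 i * partial i u (a t + c t *: zr w) +
    c' t * (Z i w * partial i u (a t + c t *: zr w))))).
  apply: eq_mean => w; rewrite partial1of2E (@derive_val _ _ _ _ _ _ _ (D w t)).
  by apply: eq_bigr => i _; rewrite !mxE; ring.
have h1 i := has_mean_shift (c t) (a t) (duc i) (uM i).
have h2 i := has_mean_wshift (c t) i (a t) (duc i) (uM i).
rewrite mean_sum; last by move=> i; apply: has_meanD; exact: has_meanZ.
by apply: eq_bigr => i _; rewrite meanD ?meanZ//; exact: has_meanZ.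
Qed.

Lemma smooth_line_derive c u y v M0 M (t : R) : C1 u -> (forall x, `|u x| <= M0) ->
  (forall i x, `|partial i u x| <= M) ->
  is_derive t 1 (fun t => smooth c u (y + t *: v))
    (\sum_i v 0 i * smooth c (partial i u) (y + t *: v)).
Proof.
move=> u1 uM0 uM.
have := @smooth_path_derive u (fun t => y + t *: v) (fun=> v) (fun=> c) (fun=> 0)
  (norm1 v) 0 M0 M t u1 uM0 uM.
under eq_bigr do rewrite mul0r addr0.
apply => //.
- by move=> s i; under eq_fun do rewrite !mxE; exact: is_derive_affine.
- by move=> _ i; rewrite /norm1 (bigD1 i)//= lerDl sumr_ge0.
- by rewrite normr0.
Qed.

(* Unification would otherwise unfold these to integrals and to limits of
   difference quotients. *)
#[local] Opaque smooth wsmooth partial.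

(** The factor [c] turns the second derivatives of the smoothed function into
[wsmooth c j (partial i u)], which is Lipschitz by the bound on the second
derivatives of [u]; no third derivative appears. The mean value theorem is
applied on the segment first to the gradient and then to the function. *)
Lemma smooth_taylor c u y v M0 M1 M2 : C2 u -> (forall x, `|u x| <= M0) ->
  (forall i x, `|partial i u x| <= M1) ->
  (forall i j x, `|partial i (partial j u) x| <= M2) ->
  `|c * (smooth c u (y + v) - smooth c u y - \sum_i v 0 i * smooth c (partial i u) y)
    - 2^-1 * \sum_i \sum_j v 0 i * v 0 j * wsmooth c j (partial i u) y|
  <= C * M2 * norm1 v ^+ 3.
Proof.
move=> [u1 u2] uM0 uM1 uM2.
pose q i := \sum_j v 0 j * wsmooth c j (partial i u) y.
have chi i t : `|t| <= 1 ->
    `|c * (smooth c (partial i u) (y + t *: v) - smooth c (partial i u) y) - t * q i|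
    <= C * M2 * norm1 v ^+ 2.
  move=> t1.
  pose Sf s := smooth c (partial i u) (y + s *: v).
  have -> : smooth c (partial i u) y = Sf 0 by rewrite /Sf scale0r addr0.
  rewrite -/(Sf t).
  have D (s : R) : is_derive s 1 (fun s => c * Sf s - s * q i)
      (\sum_j v 0 j * (wsmooth c j (partial i u) (y + s *: v) - wsmooth c j (partial i u) y)).
    have := @smooth_line_derive c (partial i u) y v M1 M2 s (u2 i) (uM1 i) (fun j => uM2 j i).
    rewrite -/Sf => d1.
    apply: is_derive_eq; rewrite /q !scaler0 ?addr0 ?add0r scaler_sumr.
    rewrite /GRing.scale/= mulr1 -sumrB; apply: eq_bigr => j _.
    by rewrite [in RHS](@wsmoothE c j _ _ M1 M2)//; ring.
  have [s st e] := @mean_value_between _ _ _ 0 t D.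
  have -> : c * (Sf t - Sf 0) - t * q i = (c * Sf t - t * q i) - (c * Sf 0 - 0 * q i).
    by move: (Sf t) (Sf 0) (q i) => ? ? ?; ring.
  rewrite !subr0 in st e; rewrite e.
  rewrite normrM -[leRHS]mulr1 ler_pM// (le_trans (ler_norm_sum _ _ _))//.
  rewrite expr2 mulrA mulrC [in leRHS]/norm1 mulr_suml; apply: ler_sum => j _.
  rewrite normrM ler_wpM2l//.
  apply: (le_trans (@wsmooth_lipschitz c j (partial i u) y (s *: v) M1 M2 _ _ _)) => //.
  rewrite ler_wpM2l ?mulr_ge0 ?normal_abs_moment_ge0 ?(le_trans _ (uM2 i i 0))//.
  rewrite /norm1; apply: ler_sum => l _; rewrite !mxE normrM ler_piMl//.
  exact: le_trans t1.
pose L := \sum_i v 0 i * smooth c (partial i u) y.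
pose qq := \sum_i v 0 i * q i.
pose Sf s := smooth c u (y + s *: v).
have S0 : smooth c u y = Sf 0 by rewrite /Sf scale0r addr0.
have S1 : smooth c u (y + v) = Sf 1 by rewrite /Sf scale1r.
have D (s : R) : is_derive s 1 (fun s => c * (Sf s - s * L) - s ^+ 2 * (2^-1 * qq))
    (\sum_i v 0 i * (c * (smooth c (partial i u) (y + s *: v) - smooth c (partial i u) y) - s * q i)).
  have := @smooth_line_derive c u y v M0 M1 s u1 uM0 uM1; rewrite -/Sf => d1.
  apply: is_derive_eq; rewrite /qq /L !scaler0 ?addr0 ?add0r.
  rewrite /GRing.scale/= !mulr1.
  under [RHS]eq_bigr do rewrite mulrBr mulrCA mulrBr mulrCA.
  rewrite sumrB -mulr_sumr -[in RHS]mulr_sumr sumrB.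
  by congr (_ - _); set S := \sum_(i < k) _; field.
have [s] := @mean_value_between _ _ _ 0 1 D.
rewrite !subr0 normr1 mulr1 => s1 e.
have qqE : \sum_i \sum_j v 0 i * v 0 j * wsmooth c j (partial i u) y = qq.
  apply: eq_bigr => i _; rewrite /q mulr_sumr; apply: eq_bigr => j _.
  by rewrite mulrA.
rewrite S0 S1 qqE -/L.
have -> (r0 r1 r2 r3 : R) : c * (r1 - r0 - r2) - 2^-1 * r3 =
  c * (r1 - 1 * r2) - 1 ^+ 2 * (2^-1 * r3) - (c * (r0 - 0 * r2) - 0 ^+ 2 * (2^-1 * r3)).
  by ring.
rewrite e.
rewrite (le_trans (ler_norm_sum _ _ _))// exprS mulrCA [in leRHS]/norm1 mulr_suml.
by apply: ler_sum => i _; rewrite normrM ler_wpM2l// chi.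
Qed.

End smoothing.

(** * Second moments of linear forms *)

(** Exchangeability speaks of permutations of all indices; joint moments of a few
coordinates only see an injection of finitely many indices. *)
Lemma perm_extends_uniq (I : finType) (l l' : seq I) : uniq l -> uniq l' ->
  size l = size l' -> exists s : {perm I}, [seq s i | i <- l] = l'.
Proof.
elim: l l' => [|x l IH] [|y l']//=; first by exists 1%g.
move=> /andP[xl ul] /andP[yl' ul'] [/(IH _ ul ul')[s sl]].
exists (s * tperm (s x) y)%g; rewrite permM tpermL; congr (_ :: _).
rewrite -[RHS]sl; apply/eq_in_map => z zl; rewrite permM tpermD//.
- by apply: contraNneq xl => /perm_inj ->.
- by apply: contraNneq yl' => ->; rewrite -sl map_f.
Qed.

Section second_moments.
Context {d : measure_display} {T : measurableType d} {R : realType}.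
Variable P : probability T R.

(** In the expanded square every diagonal term has mean [v] and every other
one [w]. *)
Lemma mean_sqr_sum (I : finType) (Y : I -> T -> R) (a : I -> R) (v w : R) :
  (forall i, measurable_fun setT (Y i)) ->
  (forall i, has_mean P (fun z => Y i z ^+ 2)) ->
  (forall i, mean P (fun z => Y i z ^+ 2) = v) ->
  (forall i j, i != j -> mean P (fun z => Y i z * Y j z) = w) ->
  has_mean P (fun z => (\sum_i a i * Y i z) ^+ 2) /\
  mean P (fun z => (\sum_i a i * Y i z) ^+ 2) =
    (v - w) * (\sum_i a i ^+ 2) + w * (\sum_i a i) ^+ 2.
Proof.
move=> mY hY Yv Yw.
have hYY i j : has_mean P (fun z => Y i z * Y j z) by exact: has_mean_mul.
have E : (fun z => (\sum_i a i * Y i z) ^+ 2) =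
    (fun z => \sum_i \sum_j a i * a j * (Y i z * Y j z)).
  apply/funext => z; rewrite expr2 big_distrlr/=.
  by apply: eq_bigr => i _; apply: eq_bigr => j _; ring.
rewrite E; split; first by do 2 (apply: has_mean_sum => ?); exact: has_meanZ.
rewrite mean_sum; last by move=> i; apply: has_mean_sum => j; exact: has_meanZ.
have -> : (\sum_i a i) ^+ 2 = \sum_i \sum_j a i * a j by rewrite expr2 big_distrlr.
rewrite !mulr_sumr -big_split/=; apply: eq_bigr => i _.
rewrite mean_sum; last by move=> j; exact: has_meanZ.
rewrite (bigD1 i)//= [in RHS](bigD1 i)//= mulrDr mulr_sumr addrA meanZ//; congr (_ + _).
  have -> : mean P (fun z => Y i z * Y i z) = v.
    by rewrite -(Yv i); apply: eq_mean => z; rewrite expr2.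
  by rewrite expr2; ring.
by apply: eq_bigr => j ji; rewrite meanZ// Yw 1?eq_sym// mulrC.
Qed.

Lemma mean_sqr_sum_le (I : finType) (Y : I -> T -> R) (a : I -> R) (v w : R) :
  (forall i, measurable_fun setT (Y i)) ->
  (forall i, has_mean P (fun z => Y i z ^+ 2)) ->
  (forall i, mean P (fun z => Y i z ^+ 2) = v) ->
  (forall i j, i != j -> mean P (fun z => Y i z * Y j z) = w) ->
  `|w| <= v ->
  mean P (fun z => (\sum_i a i * Y i z) ^+ 2) <=
    2 * v * (\sum_i a i ^+ 2) + `|w| * (\sum_i a i) ^+ 2.
Proof.
move=> mY hY Yv Yw wv; rewrite (mean_sqr_sum _ mY hY Yv Yw).2.
have S0 : 0 <= \sum_i a i ^+ 2 by apply: sumr_ge0 => i _; exact: sqr_ge0.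
rewrite lerD ?ler_wpM2r ?sqr_ge0 ?ler_norm//.
by have := ler_norm (- w); rewrite normrN; lra.
Qed.

Lemma cross_moment_le (Y1 Y2 : T -> R) (v : R) :
  measurable_fun setT Y1 -> measurable_fun setT Y2 ->
  has_mean P (fun z => Y1 z ^+ 2) -> has_mean P (fun z => Y2 z ^+ 2) ->
  mean P (fun z => Y1 z ^+ 2) = v -> mean P (fun z => Y2 z ^+ 2) = v ->
  `|mean P (fun z => Y1 z * Y2 z)| <= v.
Proof.
move=> m1 m2 h1 h2 e1 e2.
apply: (@le_trans _ _ (mean P (fun z => 2^-1 * (Y1 z ^+ 2 + Y2 z ^+ 2)))).
  apply: norm_mean_le; [exact: has_mean_mul|exact/has_meanZ/has_meanD|].
  move=> z; have := sqr_ge0 (Y1 z - Y2 z); have := sqr_ge0 (Y1 z + Y2 z).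
  by rewrite ler_norml => ? ?; apply/andP; split; nra.
rewrite meanZ ?meanD ?e1 ?e2//; last exact: has_meanD.
lra.
Qed.

(** By the Cauchy-Schwarz inequality rho^2 is at most the second moment of the
average of the [Y i], in which the diagonal terms only weigh 1/p. *)
Lemma mean_sqr_average_le (p : nat) (Y : 'I_p -> T -> R) (rho v w : R) : (0 < p)%N ->
  (forall i, measurable_fun setT (Y i)) ->
  (forall i, has_mean P (fun z => Y i z ^+ 2)) ->
  (forall i, mean P (Y i) = rho) ->
  (forall i, mean P (fun z => Y i z ^+ 2) = v) ->
  (forall i j, i != j -> mean P (fun z => Y i z * Y j z) = w) ->
  `|w| <= v ->
  rho ^+ 2 <= 2 * v / p%:R + `|w|.
Proof.
move=> p0 mY hY Yrho Yv Yw wv.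
have pp : 0 < p%:R :> R by rewrite ltr0n.
have hY1 i : has_mean P (Y i) by exact: has_mean_sqr.
pose S z := \sum_i p%:R^-1 * Y i z.
have [hS2 _] := mean_sqr_sum (fun=> p%:R^-1) mY hY Yv Yw.
have hS : has_mean P S by apply: has_mean_sum => i; exact: has_meanZ.
have ES : mean P S = rho.
  rewrite /S mean_sum; last by move=> i; exact: has_meanZ.
  under eq_bigr do rewrite meanZ// Yrho.
  by rewrite sumr_const card_ord -(mulr_natl (p%:R^-1 * rho)) mulVKf// gt_eqF.
rewrite -ES -[leLHS]real_normK ?num_real//.
apply: (@le_trans _ _ (mean P (fun w => `|S w|) ^+ 2)).
  rewrite ler_pXn2r// ?nnegrE ?mean_ge0//.
  by apply: norm_mean_le => //; exact: has_mean_norm.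
apply: (le_trans (mean_norm_sqr hS hS2)).
apply: (le_trans (mean_sqr_sum_le (fun=> p%:R^-1) mY hY Yv Yw wv)).
rewrite !sumr_const card_ord -(mulr_natl p%:R^-1) -(mulr_natl (p%:R^-1 ^+ 2)).
have -> : p%:R * p%:R^-1 = 1 :> R by rewrite divff// gt_eqF.
suff -> : 2 * v * (p%:R * p%:R^-1 ^+ 2) + `|w| * 1 ^+ 2 = 2 * v / p%:R + `|w| by [].
by field; rewrite gt_eqF.
Qed.

End second_moments.

(** * Sums over transpositions *)

Section swaps.
Context {R : realType} {n : nat}.
Implicit Types (a b z : 'I_n -> R).

(** The relative error in the sum over all transpositions of the products of the
increments of two linear forms ([sum_swap_square]). Each term is a linear form
in the z_r^2 - 1 or a product of linear forms in the z_r; the factors 1 are kept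
so that these forms are instances of [mean_sqr_sum_le]. *)
Definition swap_error a b z : R :=
  let c r := a r * b r in let dl := \sum_r c r in
  2^-1 * (\sum_r c r * (z r ^+ 2 - 1)) +
  dl * (2 * n%:R)^-1 * (\sum_r 1 * (z r ^+ 2 - 1)) -
  n%:R^-1 * ((\sum_r c r * z r) * (\sum_r 1 * z r)) +
  n%:R^-1 * ((\sum_r a r * z r) * (\sum_r b r * z r)).

Lemma sum_swap_linear a z : \sum_r a r = 0 ->
  \sum_r \sum_s (a r - a s) * (z s - z r) = - (2 * n%:R) * \sum_r a r * z r.
Proof.
move=> a0.
have E r s : (a r - a s) * (z s - z r) =
  a r * z s + (- a r * z r) * 1 + 1 * (- a s * z s) + z r * a s by ring.
under eq_bigr do under eq_bigr do rewrite E.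
under eq_bigr do rewrite !big_split/=.
rewrite !big_split/= -!big_distrlr/= a0 mul0r mulr0 !sumr_const card_ord.
under eq_bigr do rewrite mulNr.
rewrite sumrN; ring.
Qed.

(** The summand expands into products of a function of [r] and a function of [s],
so every double sum factors. *)
Lemma sum_swap_square a b z : (0 < n)%N -> \sum_r a r = 0 -> \sum_r b r = 0 ->
  \sum_r \sum_s (a r - a s) * (b r - b s) * (z s - z r) ^+ 2 =
  4 * n%:R * (\sum_r a r * b r + swap_error a b z).
Proof.
move=> n0 a0 b0.
have E r s : (a r - a s) * (b r - b s) * (z s - z r) ^+ 2 =
  (a r * b r * z r ^+ 2) * 1 + (a r * b r) * z s ^+ 2 +
  (- 2 * (a r * b r * z r)) * z s +
  z r ^+ 2 * (a s * b s) + 1 * (a s * b s * z s ^+ 2) +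
  (- 2 * z r) * (a s * b s * z s) +
  (- (a r * z r ^+ 2)) * b s + (- a r) * (b s * z s ^+ 2) +
  (2 * (a r * z r)) * (b s * z s) +
  (- (b r * z r ^+ 2)) * a s + (- b r) * (a s * z s ^+ 2) +
  (2 * (b r * z r)) * (a s * z s) by ring.
under eq_bigr do under eq_bigr do rewrite E.
under eq_bigr do rewrite !big_split/=.
rewrite !big_split/= -!big_distrlr/= /swap_error.
rewrite !sumrN a0 b0 -!mulr_sumr oppr0 !mul0r !mulr0.
have -> : \sum_r a r * b r * (z r ^+ 2 - 1) =
    \sum_r a r * b r * z r ^+ 2 - \sum_r a r * b r.
  by rewrite -sumrB; apply: eq_bigr => r _; ring.
have -> : \sum_(r < n) (z r ^+ 2 - 1) = \sum_r z r ^+ 2 - n%:R.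
  by rewrite sumrB sumr_const card_ord.
rewrite !sumr_const card_ord.
have : n%:R != 0 :> R by rewrite pnatr_eq0 -lt0n.
move: (\sum_r a r * b r * z r ^+ 2) (\sum_r a r * b r) (\sum_(r < n) z r ^+ 2)
  (\sum_r a r * b r * z r) (\sum_(r < n) z r) (\sum_r a r * z r) (\sum_r b r * z r).
move: (n%:R : R) => N A dl B D C Sa Sb N0.
by field.
Qed.

End swaps.

(** * Moments of exchangeable sequences *)

Section estimates.
Context {R : realType}.
Implicit Types mu om ka x e N y z : R.

(** In this section [mu], [om] and [ka] are the square roots of E X_1^4, of
|E (X_1^2 - 1)(X_2^2 - 1)| and of |E X_1 X_2 X_3 X_4|; [N] is n, [x] is the
product of the fourth norms of the two coefficient vectors, and [e] is their
inner product, 0 or 1. This first bound concerns the linear form in the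
X_r^2 - 1 with coefficients a_r b_r. *)
Lemma variance_term_bound mu om x e s y : 0 <= mu -> 0 <= om -> 0 <= x -> 0 <= e ->
  e ^+ 2 = e -> 0 <= s -> s <= x ^+ 2 ->
  y <= 2 * (mu ^+ 2 - 1) * s + om ^+ 2 * e -> y <= (2 * (mu * x) + e * om) ^+ 2.
Proof.
move=> mu0 om0 x0 e0 ee s0 sx /le_trans; apply.
have -> : (2 * (mu * x) + e * om) ^+ 2 =
    4 * (mu ^+ 2 * x ^+ 2) + 4 * (mu * x * (e * om)) + om ^+ 2 * e.
  by rewrite sqrrD !exprMn ee; ring.
have : 0 <= mu * x * (e * om) by rewrite mulr_ge0// mulr_ge0.
have : mu ^+ 2 * s <= mu ^+ 2 * x ^+ 2 by rewrite ler_wpM2l ?sqr_ge0.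
have : 0 <= mu ^+ 2 * x ^+ 2 by rewrite mulr_ge0 ?sqr_ge0.
lra.
Qed.

(** The bound for the sum of all X_r^2 - 1; here N <= N^2 x^2 is where the fourth
norms absorb a factor n. *)
Lemma total_variance_term_bound mu om x N y : 0 <= mu -> 0 <= om -> 0 <= x ->
  0 < N -> 1 <= N * x ^+ 2 ->
  y <= 2 * (mu ^+ 2 - 1) * N + om ^+ 2 * N ^+ 2 ->
  y <= (N * (2 * (mu * x) + om)) ^+ 2.
Proof.
move=> mu0 om0 x0 N0 Nx /le_trans; apply.
have -> : (N * (2 * (mu * x) + om)) ^+ 2 =
    4 * (mu ^+ 2 * N * (N * x ^+ 2)) + 4 * (mu * x * om * N ^+ 2) + om ^+ 2 * N ^+ 2.
  by ring.
have : 0 <= mu * x * om * N ^+ 2.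
  by apply: mulr_ge0; rewrite ?sqr_ge0//; do 2 (apply: mulr_ge0 => //).
have : mu ^+ 2 * N <= mu ^+ 2 * N * (N * x ^+ 2).
  by rewrite ler_peMr// mulr_ge0 ?sqr_ge0// ltW.
have : 0 <= mu ^+ 2 * N by rewrite mulr_ge0 ?sqr_ge0// ltW.
lra.
Qed.

(** The bound for E X_1 X_2, starting from [cross_moment_sqr_le]. *)
Lemma cross_term_bound mu ka x N y : 0 <= mu -> 0 <= ka -> 0 <= x ->
  N^-1 <= x ^+ 2 -> y <= 8 * mu ^+ 2 / N + ka ^+ 2 ->
  y <= (3 * (mu * x) + ka) ^+ 2.
Proof.
move=> mu0 ka0 x0 Nx /le_trans; apply.
have -> : (3 * (mu * x) + ka) ^+ 2 =
  9 * (mu ^+ 2 * x ^+ 2) + 6 * (mu * x * ka) + ka ^+ 2 by ring.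
have : 8 * mu ^+ 2 / N <= 8 * mu ^+ 2 * x ^+ 2.
  by rewrite ler_wpM2l// mulr_ge0// sqr_ge0.
have : 0 <= mu * x * ka by rewrite mulr_ge0// mulr_ge0.
have : 0 <= mu ^+ 2 * x ^+ 2 by rewrite mulr_ge0 ?sqr_ge0.
lra.
Qed.

Lemma weighted_amgm la y z : 0 < la ->
  `|y * z| <= 2^-1 * (la * y ^+ 2 + la^-1 * z ^+ 2).
Proof.
move=> la0; rewrite -[y ^+ 2]real_normK ?num_real// -[z ^+ 2]real_normK ?num_real// normrM.
have : 0 <= la^-1 * (la * `|y| - `|z|) ^+ 2 by rewrite mulr_ge0 ?invr_ge0 ?sqr_ge0// ltW.
have -> : la^-1 * (la * `|y| - `|z|) ^+ 2 =
    la * `|y| ^+ 2 - 2 * (`|y| * `|z|) + la^-1 * `|z| ^+ 2 by field; rewrite gt_eqF.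
lra.
Qed.

(** Here [r] is |E X_1 X_2|. The product of the form with coefficients a_r b_r and
the sum of all X_r is split by [weighted_amgm]; for equal indices the weight N
balances the two second moments. *)
Lemma diag_product_bound N x r ka m : 0 < N -> x ^+ 2 <= x -> x <= m ->
  0 <= r -> r <= 3 * m + ka ->
  2^-1 * (N * (2 * x ^+ 2 + r) + N^-1 * (N ^+ 2 * (2 * x ^+ 2 + r))) <=
  N * (5 * m + ka).
Proof.
move=> N0 xx xm r0 rle.
have -> : 2^-1 * (N * (2 * x ^+ 2 + r) + N^-1 * (N ^+ 2 * (2 * x ^+ 2 + r))) =
  N * (2 * x ^+ 2 + r) by field; rewrite gt_eqF.
by rewrite ler_wpM2l ?(ltW N0)//; lra.
Qed.

(** For distinct indices the second moment of the first form loses its term in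
[r], and the larger weight N/x makes even the trivial bound r <= 1
sufficient. *)
Lemma offdiag_product_bound N x r m : 0 < N -> 0 < x -> x <= 1 -> x <= m ->
  r <= 1 ->
  2^-1 * (N / x * (2 * x ^+ 2) + (N / x)^-1 * (N ^+ 2 * (2 * x ^+ 2 + r))) <=
  N * (5 * m).
Proof.
move=> N0 x0 x1 xm r1.
have -> : 2^-1 * (N / x * (2 * x ^+ 2) + (N / x)^-1 * (N ^+ 2 * (2 * x ^+ 2 + r))) =
  N * (x + x ^+ 3 + 2^-1 * (r * x)) by field; rewrite !gt_eqF.
rewrite ler_wpM2l ?(ltW N0)//.
have : r * x <= x by rewrite ler_piMl// ltW.
have : x ^+ 3 <= x.
  by rewrite exprS ler_piMr ?(ltW x0)// exprn_ile1// ltW.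
lra.
Qed.

Lemma swap_error_total m om ka N e u1 u2 dc ss : 0 <= m -> 0 < N -> 0 <= e -> e <= 1 ->
  u1 <= 2 * m + e * om -> u2 <= N * (2 * m + om) ->
  dc <= N * (5 * m + e * ka) -> ss <= N * (2 * m) ->
  2^-1 * u1 + e * (2 * N)^-1 * u2 + N^-1 * dc + N^-1 * ss <=
  9 * m + e * (ka + om).
Proof.
move=> m0 N0 e0 e1 U1 U2 DC SS.
have C2 : e * (2 * N)^-1 * u2 <= e * (m + 2^-1 * om).
  rewrite -mulrA ler_wpM2l//.
  have -> : m + 2^-1 * om = (2 * N)^-1 * (N * (2 * m + om)) by field; rewrite gt_eqF.
  by rewrite ler_wpM2l// invr_ge0 mulr_ge0// ltW.
have C3 : N^-1 * dc <= 5 * m + e * ka by rewrite ler_pdivrMl.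
have C4 : N^-1 * ss <= 2 * m by rewrite ler_pdivrMl.
have em : e * m <= m by rewrite ler_piMl.
rewrite mulrDr in C2; rewrite mulrDr; lra.
Qed.

End estimates.

Section exchangeable_moments.
Context {d : measure_display} {T : measurableType d} {R : realType}.
Variables (P : probability T R) (n : nat) (X : 'I_n -> {RV P >-> R}).
Hypothesis exchX : exchangeable X.

Let mX i : measurable_fun setT (X i).
Proof. exact: (@measurable_funP _ _ _ _ setT (X i)). Qed.

(** Only the laws of the two tuples agree, so [h] is composed with the reading of
coordinates and the means are compared on the space of tuples. *)
Lemma exchangeable_mean (s : 'S_n) (h : ('I_n -> R) -> R) :
  measurable_fun setT (fun t : n.-tuple R => h (tnth t)) ->
  has_mean P (fun w => h (X^~ w)) ->
  has_mean P (fun w => h (fun i => X (s i) w)) /\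
  mean P (fun w => h (fun i => X (s i) w)) = mean P (fun w => h (X^~ w)).
Proof.
move=> mh hh.
pose Xs (s : 'S_n) w : n.-tuple R := [tuple X (s i) w | i < n].
have mXs s' : measurable_fun setT (Xs s').
  apply/measurable_fun_tnthP => i.
  by apply: eq_measurable_fun (mX (s' i)) => w _ /=; rewrite tnth_mktuple.
pose X0 : {RV P >-> n.-tuple R} := HB.pack (Xs 1%g) (isMeasurableFun.Build _ _ _ _ _ (mXs 1%g)).
pose f (t : n.-tuple R) := h (tnth t).
have fXs s' w : f (Xs s' w) = h (fun i => X (s' i) w).
  by congr h; apply/funext => i; rewrite tnth_mktuple.
have X1 w : (fun i => X ((1 : 'S_n)%g i) w) = X ^~ w.
  by apply/funext => i; rewrite perm1.
have hd : has_mean (distribution P X0) f.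
  apply: integrable_pushforward => //; first exact/measurable_EFinP.
  rewrite preimage_setT (_ : _ \o _ = EFin \o (fun w => h (X^~ w)))//.
  by apply/funext => w /=; rewrite fXs X1.
have law (A : set (n.-tuple R)) : measurable A -> P (Xs s @^-1` A) = distribution P X0 A.
  move=> mA; have := exchX s mA => /esym e.
  have T1 w : [tuple X i w | i < n] = Xs 1%g w.
    by apply/eq_from_tnth => i; rewrite !tnth_mktuple perm1.
  by rewrite [LHS]e; congr (P _); apply/seteqP; split => w /=; rewrite T1.
have e1 := has_mean_image (mXs s) law hd.
have e2 := mean_image (mXs s) law hd.
have e3 := mean_image (mXs 1%g) (fun A _ => erefl : P _ = distribution P X0 A) hd.
split.
  by rewrite (_ : (fun w => _) = f \o Xs s)//; apply/funext => w; rewrite /= fXs.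
transitivity (mean P (f \o Xs s)); first by apply: eq_mean => w; rewrite /= fXs.
by rewrite e2 -e3; apply: eq_mean => w; rewrite /= fXs X1.
Qed.

Lemma exchangeable_seq (F : seq R -> R) (l l' : seq 'I_n) : uniq l -> uniq l' ->
  size l = size l' ->
  measurable_fun setT (fun t : n.-tuple R => F [seq tnth t i | i <- l]) ->
  has_mean P (fun w => F [seq X i w | i <- l]) ->
  has_mean P (fun w => F [seq X i w | i <- l']) /\
  mean P (fun w => F [seq X i w | i <- l']) = mean P (fun w => F [seq X i w | i <- l]).
Proof.
move=> ul ul' sl mF hF; have [s sE] := perm_extends_uniq ul ul' sl.
have := exchangeable_mean s (h := fun f => F [seq f i | i <- l]) mF hF.
have -> : (fun w => F [seq X i w | i <- l']) = (fun w => F [seq X (s i) w | i <- l]).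
  by apply/funext => w; rewrite -sE -map_comp.
by [].
Qed.

Variables i1 i2 i3 i4 : 'I_n.
Hypothesis uniq_i : uniq [:: i1; i2; i3; i4].
Hypotheses (hX4 : has_mean P (fun w => X i1 w ^+ 4))
  (X1sqr : mean P (fun w => X i1 w ^+ 2) = 1).

Let m3 := mean P (fun w => `|X i1 w| ^+ 3).
Let m4 := mean P (fun w => X i1 w ^+ 4).
Let rho := mean P (fun w => X i1 w * X i2 w).
Let q := mean P (fun w => X i1 w * X i2 w * X i3 w * X i4 w).
Let v2 := mean P (fun w => (X i1 w ^+ 2 - 1) * (X i2 w ^+ 2 - 1)).

Let u12 : uniq [:: i1; i2].
Proof.
move: uniq_i; rewrite /= !inE !negb_or => /andP[/and3P[-> _ _] _] //.
Qed.

Let mX2 i : measurable_fun setT (fun w => X i w ^+ 2).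
Proof. exact: measurable_funX. Qed.

Let mt i : measurable_fun setT (fun t : n.-tuple R => tnth t i).
Proof. exact: measurable_tnth. Qed.

Lemma fourth_moment r : has_mean P (fun w => X r w ^+ 4) /\
  mean P (fun w => X r w ^+ 4) = m4.
Proof.
apply: (@exchangeable_seq (fun l => l`_0 ^+ 4) [:: i1] [:: r]) => //=.
exact: measurable_funX.
Qed.

Let hXX r : has_mean P (fun w => (X r w ^+ 2) ^+ 2).
Proof.
by under [X in has_mean _ X]eq_fun do rewrite -exprM; have [] := fourth_moment r.
Qed.

Let hX2 r : has_mean P (fun w => X r w ^+ 2).
Proof. exact: has_mean_sqr. Qed.

Lemma second_moment r : mean P (fun w => X r w ^+ 2) = 1.
Proof.
rewrite -X1sqr.
have [] := @exchangeable_seq (fun l => l`_0 ^+ 2) [:: i1] [:: r] => //=.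
by apply: measurable_funX.
Qed.

Let hX3 r : has_mean P (fun w => `|X r w| ^+ 3).
Proof.
apply: (@has_mean_le _ _ _ _ (fun w => X r w ^+ 2 + (X r w ^+ 2) ^+ 2)).
- by apply: measurable_funX; exact: measurableT_comp.
- exact: has_meanD.
move=> w; rewrite ger0_norm ?exprn_ge0// -[X r w ^+ 2]real_normK ?num_real//.
have := sqr_ge0 (`|X r w| - 1); have := normr_ge0 (X r w).
set z := `|X r w| => z0 z1.
have : 0 <= z ^+ 2 * (z - 1) ^+ 2 by rewrite mulr_ge0 ?sqr_ge0.
rewrite !exprS expr0 !mulr1; nra.
Qed.

Lemma third_moment r : has_mean P (fun w => `|X r w| ^+ 3) /\
  mean P (fun w => `|X r w| ^+ 3) = m3.
Proof.
apply: (@exchangeable_seq (fun l => `|l`_0| ^+ 3) [:: i1] [:: r]) => //=.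
by apply: measurable_funX; exact: measurableT_comp.
Qed.

Lemma cross_moment r s : r != s -> mean P (fun w => X r w * X s w) = rho.
Proof.
move=> rs.
have [] := @exchangeable_seq (fun l => l`_0 * l`_1) [:: i1; i2] [:: r; s] => //=.
- by rewrite inE rs.
- exact: measurable_funM.
- exact: has_mean_mul.
Qed.

Let hXrs r s : has_mean P (fun w => (X r w * X s w) ^+ 2).
Proof.
under [X in has_mean _ X]eq_fun do rewrite exprMn.
exact: has_mean_mul.
Qed.

Let v' := mean P (fun w => (X i1 w * X i2 w) ^+ 2).

Let cross_sqr r s : r != s -> mean P (fun w => (X r w * X s w) ^+ 2) = v'.
Proof.
move=> rs.
have [] := @exchangeable_seq (fun l => (l`_0 * l`_1) ^+ 2) [:: i1; i2] [:: r; s] => //=.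
- by rewrite inE rs.
- by apply: measurable_funX; exact: measurable_funM.
Qed.

Let v'_le : v' <= m4.
Proof.
rewrite /v'; apply: (le_trans (ler_norm _)).
under eq_mean do rewrite exprMn.
apply: cross_moment_le => //.
- by under eq_mean do rewrite -exprM; exact: (fourth_moment i1).2.
- by under eq_mean do rewrite -exprM; exact: (fourth_moment i2).2.
Qed.

Let fourfold r s t u : uniq [:: r; s; t; u] ->
  mean P (fun w => (X r w * X s w) * (X t w * X u w)) = q.
Proof.
move=> ur.
have [] := @exchangeable_seq (fun l => l`_0 * l`_1 * (l`_2 * l`_3))
   [:: i1; i2; i3; i4] [:: r; s; t; u] => //=.
- by do !apply: measurable_funM.
- by apply: has_mean_mul => //; exact: measurable_funM.
- by move=> _ ->; apply: eq_mean => w; rewrite mulrA.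
Qed.

Lemma cross_moment_le1 : `|rho| <= 1.
Proof. by apply: cross_moment_le => //; exact: second_moment. Qed.

Lemma fourth_moment_ge1 : 1 <= m4.
Proof.
have := mean_norm_sqr (hX2 i1) (hXX i1).
have -> : mean P (fun w => `|X i1 w ^+ 2|) = 1.
  by rewrite -X1sqr; apply: eq_mean => w; rewrite ger0_norm ?sqr_ge0.
by rewrite expr1n => /le_trans; apply; under eq_mean do rewrite -exprM.
Qed.

(** The products X_(2e) X_(2e+1) of disjoint pairs have mean [rho], the product of
two distinct ones has mean [q], and there are at least n/4 of them. *)
Lemma cross_moment_sqr_le : rho ^+ 2 <= 8 * m4 / n%:R + `|q|.
Proof.
pose p := n./2.
have n4 : (4 <= n)%N
  by have := max_card (mem [:: i1; i2; i3; i4]); rewrite card_ord (card_uniqP uniq_i).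
have p0 : (0 < p)%N by rewrite /p half_gt0 (leq_trans _ n4).
have e2 (e : 'I_p) b : (e.*2 + (b : bool) < n)%N.
  have := ltn_ord e; have := odd_double_half n; rewrite -/p.
  by case: b; case: (odd n) => /=; lia.
pose J e b := Ordinal (e2 e b).
have Jinj e f b c : (J e b == J f c) = (e == f) && (b == c).
  apply/eqP/andP => [/(congr1 val)/= H|[/eqP -> /eqP ->]]//; split; last first.
    by move: (congr1 odd H); rewrite !oddD !odd_double/=; case: b c {H} => -[].
  apply/eqP/val_inj => /=; move: (congr1 half H).
  by rewrite !halfD !odd_double !doubleK/=; case: b c {H} => -[]; rewrite ?addn0.
pose Y e w := X (J e false) w * X (J e true) w.
have Jft e : J e false != J e true by rewrite Jinj andbF.
have H : rho ^+ 2 <= 2 * v' / p%:R + `|q|.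
  apply: (@mean_sqr_average_le _ _ _ P p Y) => //.
  - by move=> e; exact: measurable_funM.
  - by move=> e; exact: hXrs.
  - by move=> e; exact: cross_moment.
  - by move=> e; exact: cross_sqr.
  - move=> e f ef; apply: fourfold.
    by rewrite /= !inE !Jinj !negb_or !eqxx (negbTE ef) ?andbF.
  - rewrite -(@fourfold i1 i2 i3 i4)//; apply: cross_moment_le => //.
    + exact: measurable_funM.
    + exact: measurable_funM.
    + apply: cross_sqr; move: uniq_i; rewrite /= !inE !negb_or.
      by move=> /and4P[_ _ -> _].
apply: (le_trans H); rewrite lerD2r.
have np : n%:R <= 4 * p%:R :> R.
  rewrite -natrM ler_nat /p; have := odd_double_half n; case: (odd n) => /=; lia.
have pp : 0 < p%:R :> R by rewrite ltr0n.
have nn : 0 < n%:R :> R by rewrite ltr0n (leq_trans _ n4).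
rewrite ler_pdivrMr// mulrAC ler_pdivlMr//.
have := v'_le; have m0 : 0 <= v' by apply: mean_ge0 => w; exact: sqr_ge0.
nra.
Qed.

Let V r w := X r w ^+ 2 - 1.

Let mV r : measurable_fun setT (V r).
Proof. exact: measurable_funB. Qed.

Let hV2 r : has_mean P (fun w => V r w ^+ 2).
Proof.
have E : (fun w => V r w ^+ 2) = (fun w => (X r w ^+ 2) ^+ 2 - 2 * X r w ^+ 2 + 1).
  by apply/funext => w; rewrite /V; ring.
rewrite E; apply: has_meanD; last exact: has_mean_cst.
by apply: has_meanB => //; exact: has_meanZ.
Qed.

Let EV2 r : mean P (fun w => V r w ^+ 2) = m4 - 1.
Proof.
have E : (fun w => V r w ^+ 2) = (fun w => (X r w ^+ 2) ^+ 2 - (2 * X r w ^+ 2 - 1)).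
  by apply/funext => w; rewrite /V; ring.
have h2 : has_mean P (fun w => 2 * X r w ^+ 2) by exact: has_meanZ.
rewrite E meanB//; last by apply: has_meanB => //; exact: has_mean_cst.
rewrite meanB//; last exact: has_mean_cst.
rewrite meanZ// mean_cst second_moment.
under eq_mean do rewrite -exprM; rewrite (fourth_moment r).2; ring.
Qed.

Let EVV r s : r != s -> mean P (fun w => V r w * V s w) = v2.
Proof.
move=> rs.
have [] := @exchangeable_seq (fun l => (l`_0 ^+ 2 - 1) * (l`_1 ^+ 2 - 1))
  [:: i1; i2] [:: r; s] => //=.
- by rewrite inE rs.
- by apply: measurable_funM; apply: measurable_funB => //; exact: measurable_funX.
- exact: (has_mean_mul (mV i1) (mV i2)).
Qed.

Let v2_le : `|v2| <= m4 - 1.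
Proof. exact: (cross_moment_le (mV i1) (mV i2)). Qed.

(** Each of the four terms of [swap_error] is bounded through second moments: the
two linear forms in the X_r^2 - 1 by Cauchy-Schwarz, the two products by the
arithmetic-geometric mean inequality. *)
Lemma mean_swap_error (a b : 'I_n -> R) (x : R) (e : bool) :
  \sum_r a r = 0 -> \sum_r b r = 0 -> \sum_r a r ^+ 2 = 1 -> \sum_r b r ^+ 2 = 1 ->
  \sum_r a r * b r = e%:R ->
  0 < x -> x <= 1 -> \sum_r (a r * b r) ^+ 2 <= x ^+ 2 -> n%:R^-1 <= x ^+ 2 ->
  has_mean P (fun w => swap_error a b (X^~ w)) /\
  mean P (fun w => `|swap_error a b (X^~ w)|) <=
    9 * Num.sqrt m4 * x + e%:R * (Num.sqrt `|q| + Num.sqrt `|v2|).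
Proof.
move=> a0 b0 a1 b1 abe x0 x1 abx nx.
pose c r := a r * b r.
pose U1 w := \sum_r c r * V r w.
pose U2 w := \sum_(r < n) 1 * V r w.
pose D w := \sum_r c r * X r w.
pose C w := \sum_(r < n) 1 * X r w.
pose Sa w := \sum_r a r * X r w.
pose Sb w := \sum_r b r * X r w.
have errE w : swap_error a b (X^~ w) =
    2^-1 * U1 w + e%:R * (2 * n%:R)^-1 * U2 w - n%:R^-1 * (D w * C w)
      + n%:R^-1 * (Sa w * Sb w).
  by rewrite /swap_error abe.
have mlin (f : 'I_n -> R) (Y : 'I_n -> T -> R) : (forall r, measurable_fun setT (Y r)) ->
    measurable_fun setT (fun w => \sum_r f r * Y r w).
  by move=> mY; apply: measurable_sum => r; exact: measurable_funM.
have v2m : `|v2| <= m4 - 1 := v2_le.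
have [hU1 _] := mean_sqr_sum c mV hV2 EV2 EVV.
have [hU2 _] := mean_sqr_sum (fun=> 1) mV hV2 EV2 EVV.
have [hD _] := mean_sqr_sum c mX hX2 second_moment cross_moment.
have [hC _] := mean_sqr_sum (fun=> 1) mX hX2 second_moment cross_moment.
have [hSa _] := mean_sqr_sum a mX hX2 second_moment cross_moment.
have [hSb _] := mean_sqr_sum b mX hX2 second_moment cross_moment.
have lU1 := mean_sqr_sum_le c mV hV2 EV2 EVV v2m.
have lU2 := mean_sqr_sum_le (fun=> 1) mV hV2 EV2 EVV v2m.
have lD := mean_sqr_sum_le c mX hX2 second_moment cross_moment cross_moment_le1.
have lC := mean_sqr_sum_le (fun=> 1) mX hX2 second_moment cross_moment cross_moment_le1.
have lSa := mean_sqr_sum_le a mX hX2 second_moment cross_moment cross_moment_le1.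
have lSb := mean_sqr_sum_le b mX hX2 second_moment cross_moment cross_moment_le1.
have hU1' : has_mean P U1 by apply: has_mean_sqr => //; exact: mlin.
have hU2' : has_mean P U2 by apply: has_mean_sqr => //; exact: mlin.
have hDC : has_mean P (fun w => D w * C w) by apply: has_mean_mul => //; exact: mlin.
have hSS : has_mean P (fun w => Sa w * Sb w) by apply: has_mean_mul => //; exact: mlin.
have herr : has_mean P (fun w => swap_error a b (X^~ w)).
  rewrite (_ : (fun w => _) = (fun w => 2^-1 * U1 w + e%:R * (2 * n%:R)^-1 * U2 w -
    n%:R^-1 * (D w * C w) + n%:R^-1 * (Sa w * Sb w))); last by apply/funext.
  by apply: has_meanD; [apply: has_meanB; [apply: has_meanD|]|]; exact: has_meanZ.
split => //.
have n0 : 0 < n%:R :> R.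
  by rewrite ltr0n -[n]card_ord; apply/card_gt0P; exists i1.
set N := n%:R in n0 nx *.
set mu := Num.sqrt m4; set om := Num.sqrt `|v2|; set ka := Num.sqrt `|q|.
have m41 := fourth_moment_ge1.
have mu2 : mu ^+ 2 = m4 by rewrite sqr_sqrtr// (le_trans _ m41).
have om2 : om ^+ 2 = `|v2| by rewrite sqr_sqrtr.
have ka2 : ka ^+ 2 = `|q| by rewrite sqr_sqrtr.
have mu0 : 0 <= mu by exact: sqrtr_ge0.
have om0 : 0 <= om by exact: sqrtr_ge0.
have ka0 : 0 <= ka by exact: sqrtr_ge0.
have mu1 : 1 <= mu by rewrite -[1]sqrtr1 ler_wsqrtr.
have xx : x ^+ 2 <= x by rewrite expr2 ler_piMl// ltW.
have e2 : e%:R ^+ 2 = e%:R :> R by case: (e); rewrite ?expr1n ?expr0n.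
have N2 : \sum_(r < n) 1 = N :> R by rewrite sumr_const card_ord.
have N3 : \sum_(r < n) 1 ^+ 2 = N :> R.
  by rewrite -N2; apply: eq_bigr => r _; rewrite expr1n.
rewrite N2 N3 in lU2 lC; rewrite a0 a1 expr0n/= in lSa; rewrite b0 b1 expr0n/= in lSb.
rewrite abe e2 in lU1 lD.
have lU1' := lU1; rewrite -mu2 -om2 in lU1'.
have Nx : 1 <= N * x ^+ 2 by rewrite -ler_pdivrMl// mulr1.
have mux0 : 0 <= mu * x by rewrite mulr_ge0// ltW.
have e0 : 0 <= e%:R :> R by [].
have sc0 : 0 <= \sum_i c i ^+ 2 by apply: sumr_ge0 => i _; exact: sqr_ge0.
have xw : 0 <= x by exact: ltW.
have B1 : mean P (fun w => `|U1 w|) <= 2 * (mu * x) + e%:R * om.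
  apply: mean_norm_le_sqr => //; first by apply: addr_ge0; apply: mulr_ge0.
  by apply: variance_term_bound lU1'.
have B2 : mean P (fun w => `|U2 w|) <= N * (2 * (mu * x) + om).
  apply: mean_norm_le_sqr => //.
    by apply: mulr_ge0; [exact: ltW|apply: addr_ge0 => //; apply: mulr_ge0].
  by apply: total_variance_term_bound => //; rewrite mu2 om2.
have rhole : `|rho| <= 3 * (mu * x) + ka.
  rewrite -(@ler_pXn2r _ 2)// ?nnegrE//; last by apply: addr_ge0 => //; apply: mulr_ge0.
  rewrite real_normK ?num_real//; apply: (cross_term_bound _ _ _ nx) => //.
  by rewrite mu2 ka2; exact: cross_moment_sqr_le.
have xmu : x <= mu * x by rewrite ler_peMl.
have B3 : mean P (fun w => `|D w * C w|) <= N * (5 * (mu * x) + e%:R * ka).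
  (* The weight that balances the two factors: on the diagonal both second
     moments contain [rho], off the diagonal only that of [C] does. *)
  pose la := if e then N else N / x.
  have la0 : 0 < la by rewrite /la; case: (e); rewrite // divr_gt0.
  apply: (@le_trans _ _ (2^-1 * (la * mean P (fun w => D w ^+ 2) + la^-1 * mean P (fun w => C w ^+ 2)))).
    rewrite -[la * _]meanZ// -[la^-1 * _]meanZ// -meanD; [|exact: has_meanZ..].
    rewrite -meanZ; last by apply: has_meanD; exact: has_meanZ.
    apply: le_mean; first exact: has_mean_norm.
      by apply: has_meanZ; apply: has_meanD; exact: has_meanZ.
    by move=> w; exact: weighted_amgm.
  have cD : mean P (fun w => D w ^+ 2) <= 2 * x ^+ 2 + `|rho| * e%:R.
    by apply: (le_trans lD); rewrite mulr1 lerD2r ler_wpM2l.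
  have cC : mean P (fun w => C w ^+ 2) <= N ^+ 2 * (2 * x ^+ 2 + `|rho|).
    apply: (le_trans lC); rewrite mulr1 [leRHS]mulrDr [N ^+ 2 * `|_|]mulrC lerD2r.
    by rewrite mulrCA ler_wpM2l// expr2 -mulrA ler_peMr// ltW.
  have H : la * mean P (fun w => D w ^+ 2) + la^-1 * mean P (fun w => C w ^+ 2) <=
    la * (2 * x ^+ 2 + `|rho| * e%:R) + la^-1 * (N ^+ 2 * (2 * x ^+ 2 + `|rho|)).
    by apply: lerD; rewrite ler_wpM2l// ?invr_ge0 ltW.
  apply: (le_trans (ler_wpM2l _ H)) => //.
  have rho1 := cross_moment_le1.
  rewrite /la; case: (e); rewrite ?mulr1 ?mulr0 ?addr0 ?mul0r ?addr0 ?mul1r.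
    exact: diag_product_bound.
  exact: offdiag_product_bound.
have B4 : mean P (fun w => `|Sa w * Sb w|) <= N * (2 * (mu * x)).
  apply: (@le_trans _ _ (2^-1 * (mean P (fun w => Sa w ^+ 2) + mean P (fun w => Sb w ^+ 2)))).
    rewrite -meanD// -meanZ; last exact: has_meanD.
    apply: le_mean; [exact: has_mean_norm|exact/has_meanZ/has_meanD|].
    by move=> w; have := @weighted_amgm R 1 (Sa w) (Sb w) ltr01; rewrite invr1 !mul1r.
  apply: (@le_trans _ _ (2^-1 * (2 + 2))).
    rewrite ler_wpM2l// lerD//.
      by apply: (le_trans lSa); rewrite !mulr1 mulr0 addr0.
    by apply: (le_trans lSb); rewrite !mulr1 mulr0 addr0.
  have -> : 2^-1 * (2 + 2) = 2 :> R by field.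
  rewrite mulrCA ler_peMr//.
  by rewrite (le_trans Nx)// ler_wpM2l ?(ltW n0)// (le_trans xx).
have bound w : `|swap_error a b (X^~ w)| <= 2^-1 * `|U1 w| + e%:R * (2 * N)^-1 * `|U2 w| +
    N^-1 * `|D w * C w| + N^-1 * `|Sa w * Sb w|.
  rewrite errE -/N.
  have N0 : 0 <= N^-1 by rewrite invr_ge0 ltW.
  have N1 : 0 <= (2 * N)^-1 by rewrite invr_ge0 mulr_ge0// ltW.
  have nz (y z : R) : 0 <= y -> `|y * z| <= y * `|z| by move=> y0; rewrite normrM ger0_norm.
  apply: (le_trans (ler_normD _ _)); apply: lerD; last exact: nz.
  apply: (le_trans (ler_normB _ _)); apply: lerD; last exact: nz.
  apply: (le_trans (ler_normD _ _)); apply: lerD; first exact: nz.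
  by apply: nz; rewrite mulr_ge0.
have h1 : has_mean P (fun w => 2^-1 * `|U1 w|) by exact/has_meanZ/has_mean_norm.
have h2 : has_mean P (fun w => e%:R * (2 * N)^-1 * `|U2 w|) by exact/has_meanZ/has_mean_norm.
have h3 : has_mean P (fun w => N^-1 * `|D w * C w|) by exact/has_meanZ/has_mean_norm.
have h4 : has_mean P (fun w => N^-1 * `|Sa w * Sb w|) by exact/has_meanZ/has_mean_norm.
have h12 := has_meanD h1 h2; have h123 := has_meanD h12 h3.
apply: (le_trans (le_mean (has_mean_norm herr) (has_meanD h123 h4) bound)).
rewrite (meanD h123 h4) (meanD h12 h3) (meanD h1 h2) !meanZ; [|exact: has_mean_norm..].
rewrite -mulrA; apply: swap_error_total => //.
by case: (e).
Qed.

End exchangeable_moments.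

(** * Inequalities for sums and fourth norms *)

Section power_means.
Context {R : realType}.

Lemma sum_cube_le k (y : 'I_k -> R) : (forall i, 0 <= y i) ->
  (\sum_i y i) ^+ 3 <= k%:R ^+ 2 * \sum_i y i ^+ 3.
Proof.
move=> y0; have [k0|k0] := posnP k.
  by subst k; rewrite !big_ord0 !expr0n/= mulr0.
have kk : 0 < k%:R :> R by rewrite ltr0n.
set s := \sum_i y i; pose m := s / k%:R.
have s0 : 0 <= s by exact: sumr_ge0.
have m0 : 0 <= m by rewrite divr_ge0// ltW.
(* the cube lies above its tangent at the arithmetic mean [m] *)
have tangent i : 3 * m ^+ 2 * y i - 2 * m ^+ 3 <= y i ^+ 3.
  rewrite -subr_ge0.
  have -> : y i ^+ 3 - (3 * m ^+ 2 * y i - 2 * m ^+ 3) =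
    (y i - m) ^+ 2 * (y i + 2 * m) by ring.
  by rewrite mulr_ge0 ?sqr_ge0// addr_ge0// mulr_ge0.
have : \sum_i (3 * m ^+ 2 * y i - 2 * m ^+ 3) <= \sum_i y i ^+ 3 by exact: ler_sum.
rewrite sumrB -mulr_sumr sumr_const card_ord -/s => h.
have -> : s ^+ 3 = k%:R ^+ 2 * (3 * m ^+ 2 * s - (2 * m ^+ 3) *+ k).
  by rewrite -(mulr_natr (2 * m ^+ 3)) /m; field; rewrite gt_eqF.
by rewrite ler_wpM2l ?sqr_ge0.
Qed.

Lemma cube_sub_le (p q : R) : `|p - q| ^+ 3 <= 4 * (`|p| ^+ 3 + `|q| ^+ 3).
Proof.
have h := ler_normB p q.
apply: (@le_trans _ _ ((`|p| + `|q|) ^+ 3)).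
  by rewrite lerXn2r// ?nnegrE ?addr_ge0.
rewrite -subr_ge0.
have -> : 4 * (`|p| ^+ 3 + `|q| ^+ 3) - (`|p| + `|q|) ^+ 3 =
  3 * (`|p| + `|q|) * (`|p| - `|q|) ^+ 2 by ring.
by rewrite mulr_ge0 ?sqr_ge0// mulr_ge0// addr_ge0.
Qed.

(** The left-hand side adds up the second order Taylor remainders of [c] times a
function whose gradient is [s G] and whose Hessian, multiplied by [c], is
[s^2 K]; the right-hand side isolates the sums of the increments and of their
products. *)
Lemma sum_taylor_terms (I : finType) k (A : I -> R) (D : I -> 'I_k -> R)
    (G : 'I_k -> R) (K : 'I_k -> 'I_k -> R) (c s : R) :
  \sum_p (c * (A p - \sum_i s * D p i * G i) -
    2^-1 * \sum_i \sum_j s * D p i * (s * D p j) * K i j) =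
  c * (\sum_p A p) - c * s * (\sum_i (\sum_p D p i) * G i) -
  2^-1 * s ^+ 2 * (\sum_i \sum_j (\sum_p D p i * D p j) * K i j).
Proof.
rewrite sumrB -mulr_sumr sumrB mulrBr -mulr_sumr; congr (_ - _ - _).
  rewrite -mulrA; congr (_ * _); rewrite exchange_big/= mulr_sumr.
  by apply: eq_bigr => i _; rewrite mulr_suml mulr_sumr; apply: eq_bigr => p _; ring.
rewrite -mulrA; congr (_ * _); rewrite exchange_big/= mulr_sumr.
apply: eq_bigr => i _; rewrite exchange_big/= mulr_sumr.
apply: eq_bigr => j _; rewrite mulr_suml mulr_sumr.
by apply: eq_bigr => p _; ring.
Qed.

End power_means.

Section fourth_norm.
Context {R : realType} {n : nat}.
Hypothesis n0 : (0 < n)%N.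
Implicit Types u v : 'rV[R]_n.

Lemma lpnorm_ge0 (p : R) v : 0 <= lpnorm p v.
Proof. exact: powR_ge0. Qed.

Lemma lpnormXn (p : nat) v : (0 < p)%N -> lpnorm p%:R v ^+ p = \sum_r `|v 0 r| ^+ p.
Proof.
move=> p0; rewrite -powR_mulrn ?lpnorm_ge0// -powRrM mulVf ?pnatr_eq0 -?lt0n//.
rewrite powRr1; last by apply: sumr_ge0 => r _; exact: powR_ge0.
by apply: eq_bigr => r _; rewrite powR_mulrn.
Qed.

Lemma lpnorm4E v : lpnorm 4 v ^+ 4 = \sum_r v 0 r ^+ 4.
Proof.
rewrite (@lpnormXn 4)//; apply: eq_bigr => r _.
by rewrite -[4%N]/(2 * 2)%N !exprM real_normK ?num_real.
Qed.

(** The squares v_r^2 have mean 1/n and a nonnegative variance. *)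
Lemma lpnorm4_lower v : \sum_r v 0 r ^+ 2 = 1 -> n%:R^-1 <= lpnorm 4 v ^+ 4.
Proof.
move=> v1; rewrite lpnorm4E.
have nn : n%:R != 0 :> R by rewrite pnatr_eq0 -lt0n.
have : 0 <= \sum_r (v 0 r ^+ 2 - n%:R^-1) ^+ 2 by apply: sumr_ge0 => r _; exact: sqr_ge0.
have -> : \sum_r (v 0 r ^+ 2 - n%:R^-1) ^+ 2 = \sum_r v 0 r ^+ 4 - n%:R^-1.
  under eq_bigr => r _.
    rewrite (_ : _ ^+ 2 = v 0 r ^+ 4 - 2 * n%:R^-1 * v 0 r ^+ 2 + n%:R^-1 ^+ 2); last by ring.
    over.
  rewrite big_split/= sumrB -mulr_sumr v1 sumr_const card_ord -(mulr_natl (n%:R^-1 ^+ 2)).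
  by field.
by rewrite subr_ge0.
Qed.

Lemma lpnorm4_gt0 v : \sum_r v 0 r ^+ 2 = 1 -> 0 < lpnorm 4 v.
Proof.
move=> /lpnorm4_lower h; rewrite lt_neqAle lpnorm_ge0 andbT eq_sym; apply/eqP => e.
by move: h; rewrite e expr0n/= leNgt invr_gt0 ltr0n n0.
Qed.

Lemma lpnorm4_le1 v : \sum_r v 0 r ^+ 2 = 1 -> lpnorm 4 v <= 1.
Proof.
move=> v1; rewrite -(@expr_le1 _ 4) ?lpnorm_ge0// lpnorm4E -v1.
apply: ler_sum => r _; rewrite (exprM _ 2 2) expr2 ler_piMr ?sqr_ge0//.
by rewrite -v1 (bigD1 r)//= lerDl; apply: sumr_ge0 => s _; exact: sqr_ge0.
Qed.

(** The Cauchy-Schwarz inequality for the vectors of squares; the fourth norms are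
positive, so it follows by expanding one sum of squares. *)
Lemma sum_sqr_mul_le u v : \sum_r u 0 r ^+ 2 = 1 -> \sum_r v 0 r ^+ 2 = 1 ->
  \sum_r (u 0 r * v 0 r) ^+ 2 <= (lpnorm 4 u * lpnorm 4 v) ^+ 2.
Proof.
move=> /lpnorm4_gt0 + /lpnorm4_gt0; move: (lpnorm4E u) (lpnorm4E v).
move: (lpnorm 4 u) (lpnorm 4 v) => A B uA vB A0 B0.
rewrite -(ler_pM2l (exprn_gt0 2 (mulr_gt0 A0 B0))).
have : 0 <= \sum_r (u 0 r ^+ 2 * B ^+ 2 - v 0 r ^+ 2 * A ^+ 2) ^+ 2.
  by apply: sumr_ge0 => r _; exact: sqr_ge0.
have -> : \sum_r (u 0 r ^+ 2 * B ^+ 2 - v 0 r ^+ 2 * A ^+ 2) ^+ 2 =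
    2 * ((A * B) ^+ 2 * (A * B) ^+ 2 - (A * B) ^+ 2 * \sum_r (u 0 r * v 0 r) ^+ 2).
  under eq_bigr => r _.
    rewrite (_ : _ ^+ 2 = B ^+ 4 * u 0 r ^+ 4 + A ^+ 4 * v 0 r ^+ 4 -
      2 * (A * B) ^+ 2 * (u 0 r * v 0 r) ^+ 2); last by ring.
    over.
  rewrite sumrB big_split/= -!mulr_sumr -uA -vB; ring.
by rewrite pmulr_rge0// subr_ge0.
Qed.

End fourth_norm.

(** * The exchangeable pair *)

Section stein.
Context {d d' : measure_display} {T : measurableType d} {T' : measurableType d'}
  {R : realType}.
Variables (P : probability T R) (n : nat) (X : 'I_n -> {RV P >-> R}).
Variables (k : nat) (theta : 'I_k -> 'rV[R]_n).
Variables (Q : probability T' R) (Z : 'I_k -> {RV Q >-> R}) (g : 'rV[R]_k -> R).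
Hypotheses (exchX : exchangeable X) (gaussZ : standard_gaussian Z).
Hypotheses (n0 : (0 < n)%N) (orth : orthonormal_family theta)
  (sum0 : forall i, \sum_(r < n) theta i 0 r = 0).
Hypothesis gC2c : C2c g.
Hypothesis hX4 : forall r, has_mean P (fun w => X r w ^+ 4).

Let mX r : measurable_fun setT (X r).
Proof. exact: (@measurable_funP _ _ _ _ setT (X r)). Qed.

Let th i r : R := theta i 0 r.
Let lin (z : 'I_n -> R) : 'rV[R]_k := \row_i \sum_r th i r * z r.
Let S w := lin (X ^~ w).
Let M1 := seminorm1 g.
Let M2 := seminorm2 g.
Let C := @normal_abs_moment R.

Let g1 : C1 g. Proof. by case: gC2c => -[]. Qed.
Let g2 i : C1 (partial i g). Proof. by case: gC2c => -[]. Qed.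
Let gc : continuous g. Proof. by case: g1. Qed.
Let gic i : continuous (partial i g). Proof. by case: g1. Qed.
Let gM1 i x : `|partial i g x| <= M1. Proof. exact: C2c_seminorm1. Qed.
Let gM2 i j x : `|partial i (partial j g) x| <= M2. Proof. exact: C2c_seminorm2. Qed.

Let C0 : 0 <= C. Proof. exact: normal_abs_moment_ge0. Qed.

(** The displacement of S caused by transposing the coordinates [r] and [s]. *)
Definition swap_shift (r s : 'I_n) (z : 'I_n -> R) : 'rV[R]_k :=
  \row_i ((th i r - th i s) * (z s - z r)).

Let lin_swap r s z : lin (z \o tperm r s) = lin z + swap_shift r s z.
Proof.
apply/rowP => i; rewrite !mxE.
have [<-|rs] := eqVneq r s.
  rewrite subrr mul0r addr0; apply: eq_bigr => t _ /=.
  by rewrite tperm1 perm1.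
rewrite (bigD1 r)//= (bigD1 s) 1?eq_sym//= tpermL tpermR.
rewrite [in RHS](bigD1 r)//= [in RHS](bigD1 s) 1?eq_sym//=.
rewrite [X in _ + (_ + X) = _](_ : _ = \sum_(t < n | (t != r) && (t != s)) th i t * z t); last first.
  by apply: eq_bigr => t /andP[tr ts]; rewrite tpermD// eq_sym.
ring.
Qed.

Lemma sum_swap_shift z i : \sum_r \sum_s swap_shift r s z 0 i = - (2 * n%:R) * lin z 0 i.
Proof.
rewrite mxE -(@sum_swap_linear R n (th i) z (sum0 i)).
by apply: eq_bigr => r _; apply: eq_bigr => s _; rewrite mxE.
Qed.

Lemma sum_swap_shift2 z i j :
  \sum_r \sum_s swap_shift r s z 0 i * swap_shift r s z 0 j =
  4 * n%:R * ((i == j)%:R + swap_error (th i) (th j) z).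
Proof.
have := orth i j; rewrite /dotp => <-.
rewrite -(@sum_swap_square R n (th i) (th j) z n0 (sum0 i) (sum0 j)).
apply: eq_bigr => r _; apply: eq_bigr => s _; rewrite !mxE; ring.
Qed.

Section fixed_angle.
Variables (s c : R).
Hypotheses (s0 : 0 < s) (s1 : s <= 1).

Let G i (x : 'rV[R]_k) := smooth Z c (partial i g) (s *: x).
Let K i j (x : 'rV[R]_k) := wsmooth Z c j (partial i g) (s *: x).
Let F (x : 'rV[R]_k) := smooth Z c g (s *: x).

(** Its mean at S is the derivative of the rotation at the angle with sine [s] and
cosine [c]. *)
Definition stein_operator (x : 'rV[R]_k) := \sum_i (c * x 0 i * G i x - s * K i i x).

Lemma stein_operatorE x :
  stein_operator x = c * (\sum_i x 0 i * G i x) - s * \sum_i K i i x.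
Proof.
rewrite /stein_operator !mulr_sumr -sumrB; apply: eq_bigr => i _.
by rewrite mulrA.
Qed.

(** Adding [smooth_taylor] over all transpositions: the sums of the shifts and of
their products turn the first and second order terms into the Stein operator, up
to the swap errors. *)
Lemma sum_swap_taylor z :
  `|2 * n%:R * s * stein_operator (lin z) +
    c * (\sum_r \sum_t (F (lin (z \o tperm r t)) - F (lin z))) -
    2 * n%:R * s ^+ 2 * \sum_i \sum_j swap_error (th i) (th j) z * K i j (lin z)|
  <= C * M2 * s ^+ 3 * \sum_r \sum_t norm1 (swap_shift r t z) ^+ 3.
Proof.
have [M0 gM0] := C2c_bounded gC2c.
set x := lin z; pose D (p : 'I_n * 'I_n) := swap_shift p.1 p.2 z.
pose A p := F (x + D p) - F x.
have E : 2 * n%:R * s * stein_operator x +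
    c * (\sum_r \sum_t (F (lin (z \o tperm r t)) - F x)) -
    2 * n%:R * s ^+ 2 * (\sum_i \sum_j swap_error (th i) (th j) z * K i j x) =
  \sum_p (c * (A p - \sum_i s * D p 0 i * G i x) -
    2^-1 * \sum_i \sum_j s * D p 0 i * (s * D p 0 j) * K i j x).
  rewrite sum_taylor_terms.
  have -> : \sum_r \sum_t (F (lin (z \o tperm r t)) - F x) = \sum_p A p.
    rewrite pair_bigA/=; apply: eq_bigr => -[r t] _ /=.
    by rewrite lin_swap.
  have -> : \sum_i (\sum_p D p 0 i) * G i x = - (2 * n%:R) * \sum_i x 0 i * G i x.
    rewrite mulr_sumr; apply: eq_bigr => i _.
    by rewrite mulrA -sum_swap_shift pair_bigA.
  have -> : \sum_i \sum_j (\sum_p D p 0 i * D p 0 j) * K i j x =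
      4 * n%:R * (\sum_i K i i x + \sum_i \sum_j swap_error (th i) (th j) z * K i j x).
    rewrite -big_split mulr_sumr/=; apply: eq_bigr => i _.
    have -> : K i i x = \sum_j (i == j)%:R * K i j x.
      rewrite (bigD1 i)//= eqxx mul1r big1 ?addr0// => j ji.
      by rewrite eq_sym (negbTE ji) mul0r.
    rewrite -big_split mulr_sumr/=; apply: eq_bigr => j _.
    by rewrite -mulrDl mulrA -sum_swap_shift2 pair_bigA.
  rewrite stein_operatorE.
  have H (a1 a2 a3 a4 N : R) : 2 * N * s * (c * a1 - s * a2) + c * a4 - 2 * N * s ^+ 2 * a3 =
    c * a4 - c * s * (- (2 * N) * a1) - 2^-1 * s ^+ 2 * (4 * N * (a2 + a3)) by field.
  exact: H.
rewrite E pair_bigA/= mulr_sumr; apply: (le_trans (ler_norm_sum _ _ _)).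
apply: ler_sum => p _.
have := smooth_taylor gaussZ c (s *: x) (s *: D p) (conj g1 g2) gM0 gM1 gM2.
rewrite -scalerDr -/(F x) -/(F (x + D p)) -/(A p).
have -> : norm1 (s *: D p) = s * norm1 (D p).
  rewrite /norm1 mulr_sumr; apply: eq_bigr => i _.
  by rewrite !mxE normrM (ger0_norm (ltW s0)).
rewrite exprMn mulrA; apply: le_trans.
rewrite le_eqVlt; apply/orP; left; apply/eqP; congr (`| _ * (_ - _) - _ * _ |).
  by apply: eq_bigr => i _; rewrite !mxE.
by apply: eq_bigr => i _; apply: eq_bigr => j _; rewrite !mxE.
Qed.

Let scale_cont (h : 'rV[R]_k -> R) : continuous h -> continuous (fun x : 'rV[R]_k => h (s *: x)).
Proof.
move=> hc x; apply: (@continuous_comp _ _ _ (fun x : 'rV[R]_k => s *: x)); last exact: hc.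
exact: cvgZ (cvg_cst _) cvg_id.
Qed.

Let F_cont : continuous F.
Proof.
have [M0 gM0] := C2c_bounded gC2c.
apply: scale_cont; apply: (@norm1_lipschitz_continuous _ _ _ M1) => y dl.
exact: smooth_lipschitz gM0 gM1.
Qed.

Let G_cont i : continuous (G i).
Proof.
apply: scale_cont; apply: (@norm1_lipschitz_continuous _ _ _ M2) => y dl.
by apply: smooth_lipschitz => //; exact: g2.
Qed.

Let K_cont i j : continuous (K i j).
Proof.
apply: scale_cont; apply: (@norm1_lipschitz_continuous _ _ _ (C * M2)) => y dl.
by apply: wsmooth_lipschitz => //; exact: g2.
Qed.

Let mlin : forall i, measurable_fun setT (fun w => \sum_r th i r * X r w).
Proof. by move=> i; apply: measurable_sum => r; exact: measurable_funM. Qed.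

Let mS (h : 'rV[R]_k -> R) : continuous h -> measurable_fun setT (fun w => h (S w)).
Proof. by move=> hc; exact: measurable_continuous_row. Qed.

Let mtup (h : 'rV[R]_k -> R) : continuous h ->
  measurable_fun setT (fun t : n.-tuple R => h (lin (tnth t))).
Proof.
move=> hc; apply: measurable_continuous_row => // i.
by apply: measurable_sum => r; apply: measurable_funM => //; exact: measurable_tnth.
Qed.

Let hX r : has_mean P (X r).
Proof.
apply: has_mean_sqr => //; apply: has_mean_sqr; first exact: measurable_funX.
by under [X in has_mean _ X]eq_fun do rewrite -exprM; exact: hX4.
Qed.

Lemma has_mean_coordinate i : has_mean P (fun w => S w 0 i).
Proof.
rewrite (_ : (fun w => _) = (fun w => \sum_r th i r * X r w)).
  by apply: has_mean_sum => r; exact: has_meanZ.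
by apply/funext => w; rewrite mxE.
Qed.

Let G_bound i x : `|G i x| <= M1.
Proof. exact: smooth_bound. Qed.

Let K_bound i j x : `|K i j x| <= M1 * C.
Proof. exact: wsmooth_bound. Qed.

Lemma has_mean_stein : has_mean P (fun w => stein_operator (S w)).
Proof.
apply: has_mean_sum => i; apply: has_meanB.
  apply: (@has_mean_le _ _ _ _ (fun w => M1 * `|c * S w 0 i|)).
  - apply: measurable_funM; last exact: mS.
    exact: has_mean_measurable (has_meanZ c (has_mean_coordinate i)).
  - exact/has_meanZ/has_mean_norm/has_meanZ/has_mean_coordinate.
  - by move=> w; rewrite normrM mulrC ler_wpM2r.
apply: has_meanZ; apply: (@has_mean_bounded _ _ _ _ _ (M1 * C)) => //.
exact: mS.
Qed.

Lemma has_mean_smooth : has_mean P (fun w => smooth Z c g (s *: S w)).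
Proof.
have [M0 gM0] := C2c_bounded gC2c.
apply: (@has_mean_bounded _ _ _ _ (fun w => F (S w)) M0); first exact: mS.
by move=> w; exact: smooth_bound.
Qed.

(** Exchangeability enters here: a transposition does not change the law of X. *)
Lemma mean_swap r t :
  has_mean P (fun w => F (lin (X^~ w \o tperm r t)) - F (S w)) /\
  mean P (fun w => F (lin (X^~ w \o tperm r t)) - F (S w)) = 0.
Proof.
have hF : has_mean P (fun w => F (S w)) := has_mean_smooth.
have [h e] := exchangeable_mean exchX (tperm r t) (h := fun f => F (lin f)) (mtup F_cont) hF.
split; first exact: (has_meanB h hF).
by rewrite (meanB h hF) e subrr.
Qed.

Variable m3 : R.
Hypothesis third : forall r, has_mean P (fun w => `|X r w| ^+ 3) /\
  mean P (fun w => `|X r w| ^+ 3) = m3.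
Hypothesis herr : forall i j, has_mean P (fun w => swap_error (th i) (th j) (X^~ w)).

Let T3 := \sum_i \sum_r `|th i r| ^+ 3.

(** Take means in [sum_swap_taylor], where the increments of [F] disappear, and
divide by 2 n s. *)
Lemma stein_mean_bound :
  `|mean P (fun w => stein_operator (S w))| <=
  M1 * C * (\sum_i \sum_j mean P (fun w => `|swap_error (th i) (th j) (X^~ w)|)) +
  32 * C * M2 * k%:R ^+ 2 * m3 * T3.
Proof.
have M20 : 0 <= M2 := seminorm2_ge0 g.
have nn : 0 < n%:R :> R by rewrite ltr0n.
pose W w := stein_operator (S w).
pose B w := \sum_r \sum_t (F (lin (X^~ w \o tperm r t)) - F (S w)).
pose E w := \sum_i \sum_j swap_error (th i) (th j) (X^~ w) * K i j (S w).
pose H w := \sum_r \sum_t k%:R ^+ 2 * \sum_i (16 * (`|th i r| ^+ 3 + `|th i t| ^+ 3)) *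
  (`|X t w| ^+ 3 + `|X r w| ^+ 3).
have hW : has_mean P W := has_mean_stein.
have hB : has_mean P B by do 2 (apply: has_mean_sum => ?); exact: (mean_swap _ _).1.
have EB : mean P B = 0.
  rewrite mean_sum => [|r]; last by apply: has_mean_sum => t; exact: (mean_swap _ _).1.
  apply: big1 => r _; rewrite mean_sum => [|t]; last exact: (mean_swap _ _).1.
  by apply: big1 => t _; exact: (mean_swap _ _).2.
have hEK i j : has_mean P (fun w => swap_error (th i) (th j) (X^~ w) * K i j (S w)).
  apply: (@has_mean_le _ _ _ _ (fun w => M1 * C * `|swap_error (th i) (th j) (X^~ w)|)).
  - by apply: measurable_funM; [exact: has_mean_measurable|exact: mS].
  - exact/has_meanZ/has_mean_norm.
  - by move=> w; rewrite normrM mulrC ler_wpM2r.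
have hE : has_mean P E by do 2 (apply: has_mean_sum => ?).
have hX3 r t : has_mean P (fun w => `|X t w| ^+ 3 + `|X r w| ^+ 3).
  by apply: has_meanD; exact: (third _).1.
have hH : has_mean P H.
  do 2 (apply: has_mean_sum => ?); apply: has_meanZ; apply: has_mean_sum => i.
  exact: has_meanZ.
have EH : mean P H = 64 * k%:R ^+ 2 * n%:R * m3 * T3.
  rewrite mean_sum => [|r]; last first.
    apply: has_mean_sum => ?; apply: has_meanZ; apply: has_mean_sum => i; exact: has_meanZ.
  transitivity (\sum_r \sum_t \sum_i (k%:R ^+ 2 * 32 * m3) * (`|th i r| ^+ 3 + `|th i t| ^+ 3)).
    apply: eq_bigr => r _; rewrite mean_sum => [|t]; last first.
      apply: has_meanZ; apply: has_mean_sum => i; exact: has_meanZ.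
    apply: eq_bigr => t _; rewrite meanZ; last by apply: has_mean_sum => i; exact: has_meanZ.
    rewrite mean_sum => [|i]; last exact: has_meanZ.
    rewrite mulr_sumr; apply: eq_bigr => i _; rewrite meanZ//.
    rewrite meanD; [|exact: (third _).1..]; rewrite !(third _).2; ring.
  under eq_bigr do rewrite exchange_big/=.
  rewrite exchange_big/= /T3 mulr_sumr; apply: eq_bigr => i _.
  under eq_bigr do rewrite -mulr_sumr big_split/= sumr_const card_ord.
  rewrite -mulr_sumr big_split/= sumr_const card_ord -sumrMnl.
  under eq_bigr do rewrite -mulr_natr.
  rewrite -mulr_suml -mulr_natr; ring.
have key w : `|2 * n%:R * s * W w + c * B w - 2 * n%:R * s ^+ 2 * E w| <= C * M2 * s ^+ 3 * H w.
  apply: (le_trans (sum_swap_taylor _)); rewrite ler_wpM2l//.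
    by rewrite mulr_ge0 ?exprn_ge0 ?mulr_ge0// ltW.
  apply: ler_sum => r _; apply: ler_sum => t _.
  apply: (le_trans (sum_cube_le _)) => //.
  rewrite ler_wpM2l ?sqr_ge0//; apply: ler_sum => i _.
  rewrite mxE normrM exprMn.
  apply: (@le_trans _ _ ((4 * (`|th i r| ^+ 3 + `|th i t| ^+ 3)) *
     (4 * (`|X t w| ^+ 3 + `|X r w| ^+ 3)))).
    by apply: ler_pM; rewrite ?exprn_ge0//; exact: cube_sub_le.
  rewrite le_eqVlt; apply/orP; left; apply/eqP; ring.
have hnsW : has_mean P (fun w => 2 * n%:R * s * W w) by exact: has_meanZ.
have hcB : has_mean P (fun w => c * B w) by exact: has_meanZ.
have hnsE : has_mean P (fun w => 2 * n%:R * s ^+ 2 * E w) by exact: has_meanZ.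
have := norm_mean_le (has_meanB (has_meanD hnsW hcB) hnsE) (has_meanZ (C * M2 * s ^+ 3) hH) key.
rewrite (meanB (has_meanD hnsW hcB) hnsE) (meanD hnsW hcB) !meanZ// EB EH mulr0 addr0.
have EE : `|mean P E| <= M1 * C * (\sum_i \sum_j mean P (fun w => `|swap_error (th i) (th j) (X^~ w)|)).
  rewrite mean_sum => [|i]; last exact: has_mean_sum.
  rewrite mulr_sumr; apply: (le_trans (ler_norm_sum _ _ _)); apply: ler_sum => i _.
  rewrite mean_sum//.
  rewrite mulr_sumr; apply: (le_trans (ler_norm_sum _ _ _)); apply: ler_sum => j _.
  rewrite -meanZ; last exact: has_mean_norm.
  apply: norm_mean_le => //; first exact/has_meanZ/has_mean_norm.
  by move=> w; rewrite normrM mulrC ler_wpM2r.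
have m30 : 0 <= m3.
  by rewrite -(third (Ordinal n0)).2; apply: mean_ge0 => w; rewrite exprn_ge0.
have T30 : 0 <= T3 by do 2 (apply: sumr_ge0 => ? _); rewrite exprn_ge0.
move=> main.
have step : 2 * n%:R * s * `|mean P W| <=
    2 * n%:R * s * (s * `|mean P E| + s ^+ 2 * (32 * C * M2 * k%:R ^+ 2 * m3 * T3)).
  have -> : 2 * n%:R * s * `|mean P W| = `|2 * n%:R * s * mean P W|.
    by rewrite [RHS]normrM (@ger0_norm _ (2 * n%:R * s))// !mulr_ge0// ltW.
  have -> : 2 * n%:R * s * (s * `|mean P E| + s ^+ 2 * (32 * C * M2 * k%:R ^+ 2 * m3 * T3)) =
    2 * n%:R * s ^+ 2 * `|mean P E| + C * M2 * s ^+ 3 * (64 * k%:R ^+ 2 * n%:R * m3 * T3).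
    by ring.
  have -> : 2 * n%:R * s ^+ 2 * `|mean P E| = `|2 * n%:R * s ^+ 2 * mean P E|.
    by rewrite [RHS]normrM (@ger0_norm _ (2 * n%:R * s ^+ 2))// !mulr_ge0 ?sqr_ge0// ltW.
  rewrite -[X in `|X| <= _](subrK (2 * n%:R * s ^+ 2 * mean P E)).
  by rewrite (le_trans (ler_normD _ _))// addrC lerD2l.
have p0 : 0 < 2 * n%:R * s by rewrite !mulr_gt0.
rewrite (ler_pM2l p0) in step; apply: (le_trans step); apply: lerD.
  by apply: le_trans EE; rewrite ler_piMl.
rewrite ler_piMl//; last by rewrite exprn_ile1// ltW.
by rewrite !mulr_ge0 ?sqr_ge0.
Qed.

End fixed_angle.

(** The path from the law of Z, at angle 0, to that of S, at angle pi/2. *)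
Let rotation t := mean P (fun w => smooth Z (cos t) g (sin t *: S w)).

Let rotation_derive (t : R) :
  is_derive t 1 rotation (mean P (fun w => stein_operator (sin t) (cos t) (S w))).
Proof.
have [M0 gM0] := C2c_bounded gC2c.
pose F u w := smooth Z (cos u) g (sin u *: S w).
have D (w : T) (u : R) : is_derive u 1 (F ^~ w) (stein_operator (sin u) (cos u) (S w)).
  rewrite /F; move: (S w) => x.
  have := @smooth_path_derive _ _ _ _ _ _ gaussZ g (fun u => sin u *: x)
    (fun u => cos u *: x) cos (fun u => - sin u) (norm1 x) 1 M0 M1 u g1 gM0 gM1.
  have -> : \sum_i ((cos u *: x) 0 i * smooth Z (cos u) (partial i g) (sin u *: x) +
      - sin u * wsmooth Z (cos u) i (partial i g) (sin u *: x)) =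
      stein_operator (sin u) (cos u) x.
    by apply: eq_bigr => i _; rewrite mxE mulNr.
  apply.
  - move=> v i; under eq_fun do rewrite mxE.
    rewrite mxE; move: (x 0 i) => y.
    suff: is_derive v (1 : R) (fun u => sin u * y : R) (cos v * y) by [].
    have dsin := is_derive_sin v.
    by apply: is_derive_eq; rewrite scaler0 add0r /GRing.scale/= mulrC.
  - move=> v i; rewrite mxE normrM /norm1 (bigD1 i)//=.
    rewrite (@le_trans _ _ `|x 0 i|)//; last by rewrite lerDl sumr_ge0.
    by rewrite ler_piMl// ler_norml cos_geN1 cos_le1.
  - by move=> v; rewrite normrN ler_norml sin_geN1 sin_le1.
pose H w := \sum_i (`|S w 0 i| * M1 + M1 * C).
have intF u : `]t - 1, t + 1[%classic u -> P.-integrable setT (EFin \o F u).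
  by move=> _; exact: has_mean_smooth.
have dF u w : `]t - 1, t + 1[%classic u -> [set: T] w -> derivable (F ^~ w) u 1.
  by move=> _ _; exact: ex_derive.
have It : `]t - 1, t + 1[%classic t.
  by rewrite /= in_itv/= ltrDl ltrBlDr ltrDl ltr01.
have H0 w : 0 <= H w.
  by apply: sumr_ge0 => i _; rewrite addr_ge0 ?mulr_ge0 ?(le_trans _ (gM1 i 0)).
have intH : has_mean P H.
  apply: has_mean_sum => i; apply: has_meanD; last exact: has_mean_cst.
  exact/has_meanZr/has_mean_norm/has_mean_coordinate.
have Hub u w : `]t - 1, t + 1[%classic u -> [set: T] w -> `|partial1of2 F u w| <= H w.
  move=> _ _; rewrite partial1of2E (@derive_val _ _ _ _ _ _ _ (D w u)).
  rewrite (le_trans (ler_norm_sum _ _ _))//; apply: ler_sum => i _.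
  rewrite (le_trans (ler_normB _ _))//; apply: lerD; rewrite normrM.
    apply: ler_pM => //; last exact: smooth_bound.
    by rewrite normrM ler_piMl// ler_norml cos_geN1 cos_le1.
  apply: (@le_trans _ _ `|wsmooth Z (cos u) i (partial i g) (sin u *: S w)|).
    by rewrite ler_piMl// ler_norml sin_geN1 sin_le1.
  exact: wsmooth_bound.
have der := derivable_under_integral measurableT It intF dF H0 intH Hub.
have val := differentiation_under_integral measurableT It intF dF H0 intH Hub.
suff <- : (fun u => \int[P]_(w in setT) F u w)^`()%classic t =
    mean P (fun w => stein_operator (sin t) (cos t) (S w)).
  by rewrite derive1E; split.
rewrite val.
by apply: eq_mean => w; rewrite partial1of2E (@derive_val _ _ _ _ _ _ _ (D w t)).
Qed.

(** The mean value theorem along the rotation; the factor 2 bounds pi/2. *)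
Lemma gaussian_comparison (m3 : R) :
  (forall r, has_mean P (fun w => `|X r w| ^+ 3) /\ mean P (fun w => `|X r w| ^+ 3) = m3) ->
  (forall i j, has_mean P (fun w => swap_error (th i) (th j) (X^~ w))) ->
  `|mean P (fun w => g (S w)) - mean Q (fun w => g (\row_i Z i w))| <=
  2 * (M1 * C * (\sum_i \sum_j mean P (fun w => `|swap_error (th i) (th j) (X^~ w)|)) +
  32 * C * M2 * k%:R ^+ 2 * m3 * \sum_i \sum_r `|th i r| ^+ 3).
Proof.
move=> third herr; have pi2 : 0 < pi / 2 :> R by rewrite divr_gt0// pi_gt0.
have <- : rotation (pi / 2) = mean P (fun w => g (S w)).
  by apply: eq_mean => w; rewrite cos_pihalf sin_pihalf scale1r smooth_at0.
have <- : rotation 0 = mean Q (fun w => g (\row_i Z i w)).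
  rewrite -(mean_cst P (mean Q _)).
  by apply: eq_mean => w; rewrite cos0 sin0 scale0r smooth_std.
have [t tI ->] := @MVT _ rotation _ _ _ pi2 (fun t _ => rotation_derive t)
  (@derivable_within_continuous _ _ _ _ (fun t _ => @ex_derive _ _ _ _ _ _ _ (rotation_derive t))).
have [t0 tpi2] : 0 < t /\ t < pi / 2 by move: tI; rewrite in_itv/= => /andP[].
have s0 : 0 < sin t by rewrite sin_gt0_pi// t0 (lt_trans tpi2)// ltr_pdivrMr// ltr_pMr ?pi_gt0 ?ltr1n.
have bd := stein_mean_bound (cos t) s0 (sin_le1 t) third herr.
rewrite normrM subr0 (gtr0_norm pi2) mulrC.
apply: ler_pM => //; first exact: ltW.
exact: ltW (pihalf_lt2 R).
Qed.

Variables i1 i2 i3 i4 : 'I_n.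
Hypothesis uniq_i : uniq [:: i1; i2; i3; i4].
Hypothesis X1sqr : mean P (fun w => X i1 w ^+ 2) = 1.

(** The double sum over i and j of the mean swap errors factors: the products of
the fourth norms add up to a square, and the Kronecker deltas to k. *)
Lemma gaussian_comparison_moments :
  `|mean P (fun w => g (S w)) - mean Q (fun w => g (\row_i Z i w))| <=
  2 * C * k%:R * M1 *
    (Num.sqrt `|mean P (fun w => X i1 w * X i2 w * X i3 w * X i4 w)| +
     Num.sqrt `|mean P (fun w => (X i1 w ^+ 2 - 1) * (X i2 w ^+ 2 - 1))|) +
  18 * C * M1 * Num.sqrt (mean P (fun w => X i1 w ^+ 4)) *
    (\sum_i lpnorm 4 (theta i)) ^+ 2 +
  64 * C * k%:R ^+ 2 * M2 * mean P (fun w => `|X i1 w| ^+ 3) *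
    \sum_i lpnorm 3 (theta i) ^+ 3.
Proof.
set q := mean P (fun w => X i1 w * _ * _ * _).
set v := mean P (fun w => (X i1 w ^+ 2 - 1) * _).
set m4 := mean P (fun w => X i1 w ^+ 4).
set m3 := mean P (fun w => `|X i1 w| ^+ 3).
have unit i : \sum_r th i r ^+ 2 = 1.
  transitivity ((i == i)%:R : R); last by rewrite eqxx.
  by rewrite -(orth i i) /dotp; apply: eq_bigr => r _; rewrite expr2.
pose t i := lpnorm 4 (theta i).
have t0 i : 0 < t i := lpnorm4_gt0 n0 (unit i).
have t1 i : t i <= 1 := lpnorm4_le1 (unit i).
have tn i : n%:R^-1 <= t i ^+ 4 := lpnorm4_lower n0 (unit i).
have tt i j : \sum_r (th i r * th j r) ^+ 2 <= (t i * t j) ^+ 2 :=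
  sum_sqr_mul_le n0 (unit i) (unit j).
rewrite -[\sum_i lpnorm 4 (theta i)]/(\sum_i t i); clearbody t.
have err i j : has_mean P (fun w => swap_error (th i) (th j) (X^~ w)) /\
    mean P (fun w => `|swap_error (th i) (th j) (X^~ w)|) <=
    9 * Num.sqrt m4 * (t i * t j) + (i == j)%:R * (Num.sqrt `|q| + Num.sqrt `|v|).
  apply: (@mean_swap_error _ _ _ _ _ _ exchX _ _ _ _ uniq_i (hX4 i1) X1sqr).
  - exact: sum0.
  - exact: sum0.
  - exact: unit.
  - exact: unit.
  - exact: orth.
  - by rewrite mulr_gt0.
  - by apply: mulr_ile1; rewrite ?t1 ?(ltW (t0 _)).
  - exact: tt.
  - rewrite -(@ler_pXn2r _ 2)// ?nnegrE ?invr_ge0 ?sqr_ge0//.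
    have -> : (t i * t j) ^+ 2 ^+ 2 = t i ^+ 4 * t j ^+ 4 by ring.
    by rewrite expr2 ler_pM ?invr_ge0.
have third r := third_moment exchX (hX4 i1) r.
apply: (le_trans (gaussian_comparison third (fun i j => (err i j).1))).
have M10 : 0 <= M1 := seminorm1_ge0 g.
have sums : \sum_i \sum_j mean P (fun w => `|swap_error (th i) (th j) (X^~ w)|) <=
    9 * Num.sqrt m4 * (\sum_i t i) ^+ 2 +
    k%:R * (Num.sqrt `|q| + Num.sqrt `|v|).
  apply: (@le_trans _ _ (\sum_i (9 * Num.sqrt m4 * t i *
      (\sum_j t j) + (Num.sqrt `|q| + Num.sqrt `|v|)))).
    apply: ler_sum => i _.
    apply: (le_trans (ler_sum _ (fun j _ => (err i j).2))).
    rewrite big_split/= le_eqVlt; apply/orP; left; apply/eqP; congr (_ + _).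
      by rewrite mulr_sumr; apply: eq_bigr => j _; ring.
    rewrite (bigD1 i)//= eqxx mul1r big1 ?addr0// => j ji.
    by rewrite eq_sym (negbTE ji) mul0r.
  rewrite big_split/= sumr_const card_ord -mulr_suml -mulr_sumr -mulr_natl.
  by rewrite le_eqVlt; apply/orP; left; apply/eqP; ring.
have T3E : \sum_i \sum_r `|th i r| ^+ 3 = \sum_i lpnorm 3 (theta i) ^+ 3.
  by apply: eq_bigr => i _; rewrite (@lpnormXn _ _ 3).
rewrite T3E.
have := ler_wpM2l (mulr_ge0 M10 C0) sums.
set a1 := \sum_i \sum_j _; set a2 := (\sum_i _) ^+ 2; set a3 := (X in _ -> _ <= _ + _ * X).
rewrite -/m3 => h.
have -> : 2 * C * k%:R * M1 * (Num.sqrt `|q| + Num.sqrt `|v|) +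
  18 * C * M1 * Num.sqrt m4 * a2 + 64 * C * k%:R ^+ 2 * M2 * m3 * a3 =
  2 * (M1 * C * (9 * Num.sqrt m4 * a2 + k%:R * (Num.sqrt `|q| + Num.sqrt `|v|)) +
    32 * C * M2 * k%:R ^+ 2 * m3 * a3) by ring.
by rewrite ler_pM2l// lerD2r.
Qed.

End stein.

(** * Extended-real expectations *)

Section expectations.
Context {d : measure_display} {T : measurableType d} {R : realType}.
Variable P : probability T R.
Implicit Types (f : T -> R) (x : \bar R).

Lemma mean_expectation f : mean P f = fine ('E_P[f])%E.
Proof. by rewrite unlock. Qed.

Lemma expectation_mean f : has_mean P f -> ('E_P[f] = (mean P f)%:E)%E.
Proof.
move=> hf; rewrite mean_expectation fineK// unlock.
exact: integrable_fin_num.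
Qed.

Lemma expectation_infinite f : measurable_fun setT f -> (forall w, 0 <= f w) ->
  ~ has_mean P f -> ('E_P[f] = +oo)%E.
Proof.
move=> mf f0 nf; apply/eqP; rewrite -leye_eq leNgt; apply/negP => fy; apply: nf.
apply/integrableP; split; first exact/measurable_EFinP.
by under eq_integral => w _ do rewrite /= (ger0_norm (f0 w)); move: fy; rewrite unlock.
Qed.

(** As [fine] sends the infinite values to 0, a bound in terms of real moments
implies the same bound in terms of the extended-real ones, whether or not these
are finite. *)
Lemma fine_le x : (0 <= x)%E -> ((fine x)%:E <= x)%E.
Proof. by case: x => [y||]//= _; rewrite leey. Qed.

Lemma norm_fine_le x : (`|fine x|%:E <= `|x|)%E.
Proof. by case: x => [y||]//=; rewrite normr0 leey. Qed.

Lemma sqrt_norm_mean_le f : ((Num.sqrt `|mean P f|)%:E <= sqrte `|'E_P[f]|)%E.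
Proof.
rewrite mean_expectation; apply: (@le_trans _ _ (sqrte `|fine 'E_P[f]|%:E)%E) => //.
by rewrite lee_sqrt ?abse_ge0// norm_fine_le.
Qed.

Lemma sqrt_mean_le f : (forall w, 0 <= f w) ->
  ((Num.sqrt (mean P f))%:E <= sqrte 'E_P[f])%E.
Proof.
move=> f0; rewrite mean_expectation; apply: (@le_trans _ _ (sqrte (fine 'E_P[f])%:E)%E) => //.
by rewrite lee_sqrt ?fine_le ?expectation_ge0.
Qed.

End expectations.

Theorem theorem4 (R : realType) :
  exists a b c : R,
  forall (d : measure_display) (T : measurableType d) (P : probability T R)
    (n : nat) (hn : (4 <= n)%N) (X : 'I_n -> {RV P >-> R})
    (k : nat) (theta : 'I_k -> 'rV[R]_n)
    (d' : measure_display) (T' : measurableType d') (Q : probability T' R)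
    (Z : 'I_k -> {RV Q >-> R})
    (g : 'rV[R]_k -> R),
  let X1 : {RV P >-> R} := X (widen_ord hn (@Ordinal 4 0 isT)) in
  let X2 : {RV P >-> R} := X (widen_ord hn (@Ordinal 4 1 isT)) in
  let X3 : {RV P >-> R} := X (widen_ord hn (@Ordinal 4 2 isT)) in
  let X4 : {RV P >-> R} := X (widen_ord hn (@Ordinal 4 3 isT)) in
  let Sn (w : T) : 'rV[R]_k :=
    \row_(i < k) dotp (theta i) (\row_(r < n) X r w) in
  exchangeable X ->
  ('E_P[X1] = 0)%E ->
  ('E_P[(fun w => X1 w ^+ 2)%R] = 1)%E ->
  orthonormal_family theta ->
  (forall i, \sum_(r < n) theta i 0 r = 0) ->
  standard_gaussian Z ->
  C2c g ->
  (`| 'E_P[(fun w => g (Sn w))%R] - 'E_Q[(fun w => g (\row_(i < k) Z i w))%R] | <=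
     (a * k%:R * seminorm1 g)%:E *
       (sqrte `| 'E_P[(fun w => X1 w * X2 w * X3 w * X4 w)%R] | +
        sqrte `| 'E_P[(fun w => (X1 w ^+ 2 - 1) * (X2 w ^+ 2 - 1))%R] |) +
     (b * seminorm1 g)%:E * sqrte 'E_P[(fun w => X1 w ^+ 4)%R] *
       ((\sum_(i < k) lpnorm 4 (theta i)) ^+ 2)%:E +
     (c * k%:R ^+ 2 * seminorm2 g)%:E * 'E_P[(fun w => `|X1 w| ^+ 3)%R] *
       (\sum_(i < k) lpnorm 3 (theta i) ^+ 3)%:E)%E.
Proof.
pose C := @normal_abs_moment R.
(* The summand 1 makes the second coefficient positive, so that an infinite
   fourth moment makes the whole bound infinite. *)
exists (2 * C), (18 * C + 1), (64 * C).
move=> d T P n hn X k theta d' T' Q Z g X1 X2 X3 X4 Sn exchX _ X1sqr orth sum0 gaussZ gC2c.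
have C0 : 0 <= C := normal_abs_moment_ge0.
have n0 : (0 < n)%N := leq_trans (isT : (0 < 4)%N) hn.
have [[g1 _] _] := gC2c.
have [gc _ _] := g1.
have [M0 gM0] := C2c_bounded gC2c.
have M10 := seminorm1_ge0 g.
have M20 := seminorm2_ge0 g.
have SE w : Sn w = \row_i \sum_r theta i 0 r * X r w.
  by apply/rowP => i; rewrite !mxE; apply: eq_bigr => r _; rewrite mxE.
have mX r : measurable_fun setT (X r) by exact: (@measurable_funP _ _ _ _ setT (X r)).
have mZ i : measurable_fun setT (Z i) by exact: (@measurable_funP _ _ _ _ setT (Z i)).
have hgS : has_mean P (fun w => g (Sn w)).
  apply: (@has_mean_bounded _ _ _ _ _ M0) => //.
  under [X in measurable_fun _ X]eq_fun do rewrite SE.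
  apply: measurable_continuous_row => // i.
  by apply: measurable_sum => r; exact: measurable_funM.
have hgZ : has_mean Q (fun w => g (\row_i Z i w)).
  by apply: (@has_mean_bounded _ _ _ _ _ M0) => //; exact: measurable_continuous_row.
rewrite (expectation_mean hgS) (expectation_mean hgZ) -EFinB abse_EFin.
set m4 := 'E_P[(fun w => X1 w ^+ 4)%R]%E.
have m40 : (0 <= m4)%E by apply: expectation_ge0 => w; rewrite (exprM _ 2 2) sqr_ge0.
have m30 : (0 <= 'E_P[(fun w => `|X1 w| ^+ 3)%R])%E.
  by apply: expectation_ge0 => w; rewrite exprn_ge0.
have t30 : 0 <= \sum_(i < k) lpnorm 3 (theta i) ^+ 3.
  by apply: sumr_ge0 => i _; rewrite exprn_ge0 ?lpnorm_ge0.
have b0 : 0 < 18 * C + 1 by rewrite ltr_wpDl ?mulr_ge0.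
have termA0 x y : (0 <= (2 * C * k%:R * seminorm1 g)%:E * (sqrte x + sqrte y))%E.
  by rewrite mule_ge0 ?adde_ge0 ?sqrte_ge0 ?lee_fin ?mulr_ge0.
have termC0 : (0 <= (64 * C * k%:R ^+ 2 * seminorm2 g)%:E * 'E_P[(fun w => `|X1 w| ^+ 3)%R] *
       (\sum_(i < k) lpnorm 3 (theta i) ^+ 3)%:E)%E.
  by rewrite !mule_ge0 ?lee_fin ?mulr_ge0 ?sqr_ge0.
have [hX4|nX4] := pselect (has_mean P (fun w => X1 w ^+ 4)).
  have h4 r : has_mean P (fun w => X r w ^+ 4) := (fourth_moment exchX hX4 r).1.
  have E2 : mean P (fun w => X1 w ^+ 2) = 1 by rewrite mean_expectation X1sqr.
  have ui : uniq [seq widen_ord hn i | i <- [:: @Ordinal 4 0 isT; @Ordinal 4 1 isT;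
      @Ordinal 4 2 isT; @Ordinal 4 3 isT]] by [].
  have := gaussian_comparison_moments exchX gaussZ n0 orth sum0 gC2c h4 ui E2.
  have -> : mean P (fun w => g (\row_i \sum_r theta i 0 r * X r w)) = mean P (fun w => g (Sn w)).
    by apply: eq_mean => w; rewrite SE.
  rewrite -lee_fin => /le_trans; apply.
  rewrite EFinD [X in (X + _)%E]EFinD; apply: leeD; first apply: leeD.
  - rewrite EFinM; apply: lee_wpmul2l; first by rewrite lee_fin !mulr_ge0.
    by rewrite EFinD; apply: leeD; exact: sqrt_norm_mean_le.
  - rewrite EFinM EFinM; apply: lee_wpmul2r; first by rewrite lee_fin sqr_ge0.
    apply: lee_pmul; rewrite ?lee_fin ?sqrtr_ge0 ?mulr_ge0//.
      by rewrite ler_wpM2r// lerDl.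
    by apply: sqrt_mean_le => w; rewrite (exprM _ 2 2) sqr_ge0.
  - rewrite EFinM EFinM; apply: lee_wpmul2r; first by rewrite lee_fin.
    apply: lee_wpmul2l; first by rewrite lee_fin !mulr_ge0 ?sqr_ge0.
    by rewrite mean_expectation fine_le.
have m4y : m4 = +oo%E.
  apply: expectation_infinite => //; first exact: measurable_funX.
  by move=> w; rewrite (exprM _ 2 2) sqr_ge0.
have [M1z|M1z] := eqVneq (seminorm1 g) 0.
  have gcst x : g x = g 0.
    apply/eqP; rewrite -subr_eq0 -normr_le0 -(add0r x).
    rewrite (le_trans (C1_lipschitz (M := 0) _ _ g1 _)) ?mul0r// => i z.
    by rewrite -M1z; exact: C2c_seminorm1.
  under eq_mean do rewrite gcst; rewrite mean_cst.
  under eq_mean do rewrite gcst; rewrite mean_cst.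
  rewrite subrr normr0 !adde_ge0// !mule_ge0 ?sqrte_ge0 ?lee_fin ?sqr_ge0//.
  exact: mulr_ge0 (ltW b0) M10.
have t40 : 0 < \sum_(i < k) lpnorm 4 (theta i).
  have k0 : (0 < k)%N.
    rewrite lt0n; apply: contraNneq M1z => k0.
    by rewrite /seminorm1 big_pred0// => i; have := ltn_ord i; rewrite {2}k0.
  rewrite (bigD1 (Ordinal k0))//= ltr_pwDl//.
    apply: lpnorm4_gt0 => //; transitivity ((Ordinal k0 == Ordinal k0)%:R : R); last by rewrite eqxx.
    by rewrite -(orth (Ordinal k0)); apply: eq_bigr => r _; rewrite expr2.
  by apply: sumr_ge0 => i _; exact: lpnorm_ge0.
rewrite m4y gt0_muley; last by rewrite lte_fin mulr_gt0// lt_neqAle eq_sym M1z.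
rewrite gt0_mulye; last by rewrite lte_fin exprn_gt0.
rewrite addey; last by rewrite -ltNye (lt_le_trans _ (termA0 _ _)).
rewrite addye; last by rewrite -ltNye (lt_le_trans _ termC0).
exact: leey.
Qed.
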